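(* Let $0<q<1$, $\phi\in[0,2\pi)$, $H=\mathcal U_{q,\phi}(\hat u(2))$, $A=SU_{q,\phi}(2)$, let $\Xi(h\otimes a)=e^{2i\phi\delta(h)\delta(a)}a\otimes h$ on homogeneous elements, and let $\langle\cdot,\cdot\rangle$ be the braided pairing between $H$ and $A$ whose values on generators are listed in the context. Then there is a braided left action of $H$ on $A$, with mutual braiding $\Xi$, defined by $$h\triangleright x=(\mathrm{id}\otimes\langle\cdot,\cdot\rangle)(\Xi\otimes\mathrm{id})(\mathrm{id}\otimes\Delta)(h\otimes x),$$ making $A$ a left braided $H$-module algebra. Furthermore, let $\Xi':A\otimes H\to H\otimes A$ be given on homogeneous elements by $\Xi'(a\otimes h)=e^{2i\phi\delta(h)\delta(a)}h\otimes a$, and regard the pairing as the map $A\otimes H\to\mathbb C$, $\langle a,h\rangle:=\langle h,a\rangle$. Then there is a right braided action of $H$ on $A$ defined by $$x\triangleleft h=(\langle\cdot,\cdot\rangle\otimes\mathrm{id})(\mathrm{id}\otimes\Xi')(\Delta\otimes\mathrm{id})(x\otimes h).$$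
   Context: $SU_{q,\phi}(2)$ is the braided Hopf algebra over $\mathbb C$ generated by $\alpha,\gamma,\alpha^*,\gamma^*$ with relations $\alpha\gamma=qe^{4i\phi}\gamma\alpha$, $\alpha\gamma^*=qe^{-4i\phi}\gamma^*\alpha$, $\gamma\alpha^*=qe^{4i\phi}\alpha^*\gamma$, $\gamma^*\alpha^*=qe^{-4i\phi}\alpha^*\gamma^*$, $\alpha\alpha^*+q^2\gamma^*\gamma=1$, $\alpha^*\alpha+\gamma\gamma^*=1$, $\gamma\gamma^*=\gamma^*\gamma$; coproduct $\Delta(\alpha)=\alpha\otimes\alpha-qe^{-4i\phi}\gamma^*\otimes\gamma$, $\Delta(\gamma)=\gamma\otimes\alpha+\alpha^*\otimes\gamma$, $\Delta(\alpha^* )=\alpha^*\otimes\alpha^*-qe^{-4i\phi}\gamma\otimes\gamma^*$, $\Delta(\gamma^* )=\gamma^*\otimes\alpha^*+\alpha\otimes\gamma^*$; counit $\epsilon(\alpha)=\epsilon(\alpha^* )=1$, $\epsilon(\gamma)=\epsilon(\gamma^* )=0$; antipode $S(\alpha)=\alpha^*$, $S(\alpha^* )=\alpha$, $S(\gamma)=-qe^{4i\phi}\gamma$, $S(\gamma^* )=-q^{-1}e^{4i\phi}\gamma^*$; its index $\delta$ is the $\mathbb Z$-grading, additive on products, with $\delta(\alpha)=\delta(\alpha^* )=0$, $\delta(\gamma)=-2$, $\delta(\gamma^* )=2$, and its braiding is $\Psi_A(a\otimes b)=e^{2i\phi\delta(a)\delta(b)}b\otimes a$ on homogeneous elements. $\mathcal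 U_{q,\phi}(\hat u(2))$ is the braided Hopf $*$-algebra over $\mathbb C$ generated by $e$, $f=e^*$ and invertible $k,k^*$ with relations $ek=qe^{-4i\phi}ke$, $kf=qe^{-4i\phi}fk$, $k^*f=qe^{4i\phi}fk^*$, $ek^*=qe^{4i\phi}k^*e$, $kk^*=k^*k$, $ef-fe=\frac1{q^{-1}-q}\left(kk^*-k^{-1}(k^* )^{-1}\right)$; coproduct $\Delta(k)=k\otimes k$, $\Delta(k^* )=k^*\otimes k^*$, $\Delta(e)=e\otimes k+k^{-1}\otimes e$, $\Delta(f)=f\otimes k^*+(k^* )^{-1}\otimes f$; counit $\epsilon(e)=\epsilon(f)=0$, $\epsilon(k)=\epsilon(k^* )=1$; antipode $S(e)=-q^{-1}e^{4i\phi}e$, $S(f)=-qe^{4i\phi}f$, $S(k)=k^{-1}$, $S(k^* )=(k^* )^{-1}$; its index $\delta$ is the $\mathbb Z$-grading, additive on products, with $\delta(e)=-2$, $\delta(f)=2$, $\delta(k)=\delta(k^* )=0$, and its braiding is $\Psi_H(x\otimes y)=e^{2i\phi\delta(x)\delta(y)}y\otimes x$ on homogeneous elements. In both cases the coproduct is an algebra homomorphism into the braided tensor product, where $(a\otimes b)(c\otimes d)=a\,\Psi(b\otimes c)\,d$. The pairing $\langle\cdot,\cdot\rangle:H\otimes A\to\mathbb C$ is the braided pairing, i.e. linear map with $\langle\cdot,\cdot\rangle(\mathrm{id}\otimes\cdot_A)=(\langle\cdot,\cdot\rangle\otimes\langle\cdot,\cdot\rangle)(\mathrm{id}\otimes\Xi\otimes\mathrm{id})(\Delta_H\otimes\mathrm{id}\otimes\mathrm{id})$,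 $\langle\cdot,\cdot\rangle(\cdot_H\otimes\mathrm{id})=(\langle\cdot,\cdot\rangle\otimes\langle\cdot,\cdot\rangle)(\mathrm{id}\otimes\Xi\otimes\mathrm{id})(\mathrm{id}\otimes\mathrm{id}\otimes\Delta_A)$, $\langle Sh,a\rangle=\langle h,Sa\rangle$, $\langle1,a\rangle=\epsilon(a)$, $\langle h,1\rangle=\epsilon(h)$, determined by the generator values $\langle e,\gamma^*\rangle=-q^{-1}e^{-4i\phi}$, $\langle f,\gamma\rangle=1$, $\langle k,\alpha\rangle=q^{-1/2}e^{2i\phi}$, $\langle k,\alpha^*\rangle=q^{1/2}e^{-2i\phi}$, $\langle k^*,\alpha\rangle=q^{-1/2}e^{-2i\phi}$, $\langle k^*,\alpha^*\rangle=q^{1/2}e^{2i\phi}$, $\langle k^{-1},\alpha\rangle=q^{1/2}e^{-2i\phi}$, $\langle k^{-1},\alpha^*\rangle=q^{-1/2}e^{2i\phi}$, $\langle(k^* )^{-1},\alpha\rangle=q^{1/2}e^{2i\phi}$, $\langle(k^* )^{-1},\alpha^*\rangle=q^{-1/2}e^{-2i\phi}$, all other pairings of generators being zero. $A$ is a left braided $H$-module algebra via $\triangleright:H\otimes A\to A$ and braiding $\Xi:H\otimes A\to A\otimes H$ if: $\Xi(\cdot_H\otimes\mathrm{id})=(\mathrm{id}\otimes\cdot_H)(\Xi\otimes\mathrm{id})(\mathrm{id}\otimes\Xi)$; $\Xi(\mathrm{id}\otimes\cdot_A)=(\cdot_A\otimes\mathrm{id})(\mathrm{id}\otimes\Xi)(\Xi\otimes\mathrm{id})$;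 $(\mathrm{id}\otimes\Delta_H)\Xi=(\Xi\otimes\mathrm{id})(\mathrm{id}\otimes\Xi)(\Delta_H\otimes\mathrm{id})$; $\triangleright(\mathrm{id}\otimes\cdot_A)=\cdot_A(\triangleright\otimes\triangleright)(\mathrm{id}\otimes\Xi\otimes\mathrm{id})(\Delta_H\otimes\mathrm{id}\otimes\mathrm{id})$; $\triangleright(\cdot_H\otimes\mathrm{id})=\triangleright(\mathrm{id}\otimes\triangleright)$; $\Xi(\mathrm{id}\otimes\triangleright)=(\triangleright\otimes\mathrm{id})(\mathrm{id}\otimes\Xi)(\Psi_H\otimes\mathrm{id})$; $1\triangleright a=a$, $h\triangleright1=\epsilon(h)1$. A right braided action with braiding $\Xi':A\otimes H\to H\otimes A$ is the mirror image: $\Xi'$ is compatible with the products of $A$ and $H$ and the coproduct of $H$ (mirror images of the first three conditions), and $\triangleleft:A\otimes H\to A$ satisfies $\triangleleft(\cdot_A\otimes\mathrm{id})=\cdot_A(\triangleleft\otimes\triangleleft)(\mathrm{id}\otimes\Xi'\otimes\mathrm{id})(\mathrm{id}\otimes\mathrm{id}\otimes\Delta_H)$, $\triangleleft(\mathrm{id}\otimes\cdot_H)=\triangleleft(\triangleleft\otimes\mathrm{id})$, $\Xi'(\triangleleft\otimes\mathrm{id})=(\mathrm{id}\otimes\triangleleft)(\Xi'\otimes\mathrm{id})(\mathrm{id}\otimes\Psi_H)$, $a\triangleleft1=a$, $1\triangleleft h=\epsilon(h)1$. *)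

(* Defs.v *)
From HB Require Import structures.
From mathcomp Require Import all_boot all_order all_algebra.
From mathcomp Require Import generic_quotient.
From mathcomp Require Import boolp reals topology normedtype trigo.
From mathcomp Require Import complex.

Set Implicit Arguments.
Unset Strict Implicit.
Unset Printing Implicit Defensive.

Import Order.TTheory GRing.Theory Num.Theory.
Local Open Scope ring_scope.
Local Open Scope quotient_scope.

Declare Scope pterm_scope.
Delimit Scope pterm_scope with pterm.

Reserved Notation "U ⊗ V" (at level 38, right associativity).
Reserved Notation "u ⊗: v" (at level 38, right associativity).

(** * Tensor product of two K-modules: formal combinations of pure tensors
    modulo the linear axioms and bilinearity *)

Section Tensor.
Variables (K : fieldType) (U V : lmodType K).

Inductive tterm : Type :=
| TPure of U & V
| TZero
| TAdd of tterm & tterm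
| TScale of K & tterm.

Inductive tcong : tterm -> tterm -> Prop :=
| tc_refl s : tcong s s
| tc_sym s t : tcong s t -> tcong t s
| tc_trans s t r : tcong s t -> tcong t r -> tcong s r
| tc_add s s' t t' : tcong s s' -> tcong t t' -> tcong (TAdd s t) (TAdd s' t')
| tc_scale c s s' : tcong s s' -> tcong (TScale c s) (TScale c s')
| tc_addA s t r : tcong (TAdd s (TAdd t r)) (TAdd (TAdd s t) r)
| tc_addC s t : tcong (TAdd s t) (TAdd t s)
| tc_add0 s : tcong (TAdd TZero s) s
| tc_scale0 s : tcong (TScale 0 s) TZero
| tc_scale1 s : tcong (TScale 1 s) s
| tc_scaleA a b s : tcong (TScale a (TScale b s)) (TScale (a * b) s)
| tc_scaleDr a s t : tcong (TScale a (TAdd s t)) (TAdd (TScale a s) (TScale a t))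
| tc_scaleDl a b s : tcong (TScale (a + b) s) (TAdd (TScale a s) (TScale b s))
| tc_pureDl u u' v : tcong (TPure (u + u') v) (TAdd (TPure u v) (TPure u' v))
| tc_pureDr u v v' : tcong (TPure u (v + v')) (TAdd (TPure u v) (TPure u v'))
| tc_pureZl a u v : tcong (TPure (a *: u) v) (TScale a (TPure u v))
| tc_pureZr a u v : tcong (TPure u (a *: v)) (TScale a (TPure u v)).

HB.instance Definition _ := gen_eqMixin tterm.
HB.instance Definition _ := gen_choiceMixin tterm.

Definition tcongb : rel tterm := fun s t => `[< tcong s t >].

Lemma tcongb_refl : reflexive tcongb.
Proof. by move=> s; apply/asboolP; apply: tc_refl. Qed.
Lemma tcongb_sym : symmetric tcongb.
Proof. by move=> s t; apply/asboolP/asboolP; apply: tc_sym. Qed.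
Lemma tcongb_trans : transitive tcongb.
Proof. by move=> t s r /asboolP h /asboolP k; apply/asboolP; apply: tc_trans k. Qed.

Canonical tcong_equiv := EquivRel tcongb tcongb_refl tcongb_sym tcongb_trans.

Definition tensor : Type := {eq_quot tcong_equiv}.
HB.instance Definition _ := Choice.on tensor.
HB.instance Definition _ := EqQuotient.on tensor.

Definition tens (u : U) (v : V) : tensor := \pi_tensor (TPure u v).

Lemma tensor_eqP (s t : tterm) : \pi_tensor s = \pi_tensor t <-> tcong s t.
Proof. by split=> [/eqmodP /asboolP|h]; last by apply/eqmodP/asboolP. Qed.

Lemma tensor_reprP (s : tterm) : tcong (repr (\pi_tensor s)) s.
Proof. by apply/tensor_eqP; rewrite reprK. Qed.

Definition tensor_zero : tensor := \pi_tensor TZero.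
Definition tensor_add (x y : tensor) : tensor := \pi_tensor (TAdd (repr x) (repr y)).
Definition tensor_scale (a : K) (x : tensor) : tensor := \pi_tensor (TScale a (repr x)).
Definition tensor_opp (x : tensor) : tensor := tensor_scale (-1) x.

Lemma tensor_addE s t : tensor_add (\pi_tensor s) (\pi_tensor t) = \pi_tensor (TAdd s t).
Proof. by apply/tensor_eqP; apply: tc_add; apply: tensor_reprP. Qed.
Lemma tensor_scaleE a s : tensor_scale a (\pi_tensor s) = \pi_tensor (TScale a s).
Proof. by apply/tensor_eqP; apply: tc_scale; apply: tensor_reprP. Qed.

Lemma tensor_addA : associative tensor_add.
Proof.
elim/quotW=> s; elim/quotW=> t; elim/quotW=> r.
rewrite (tensor_addE t r) (tensor_addE s t) !tensor_addE.
by apply/tensor_eqP; apply: tc_addA.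
Qed.
Lemma tensor_addC : commutative tensor_add.
Proof.
elim/quotW=> s; elim/quotW=> t; rewrite !tensor_addE.
by apply/tensor_eqP; apply: tc_addC.
Qed.
Lemma tensor_add0 : left_id tensor_zero tensor_add.
Proof.
elim/quotW=> s; rewrite tensor_addE; by apply/tensor_eqP; apply: tc_add0.
Qed.
Lemma tensor_addN : left_inverse tensor_zero tensor_opp tensor_add.
Proof.
elim/quotW=> s; rewrite /tensor_opp tensor_scaleE tensor_addE; apply/tensor_eqP.
apply: tc_trans (tc_scale0 s); apply: tc_sym; rewrite -(addNr 1).
apply: tc_trans (tc_scaleDl _ _ _) _; apply: tc_add (tc_refl _) (tc_scale1 _).
Qed.

HB.instance Definition _ := GRing.isZmodule.Build tensor
  tensor_addA tensor_addC tensor_add0 tensor_addN.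

Lemma tensor_scaleA a b x :
  tensor_scale a (tensor_scale b x) = tensor_scale (a * b) x.
Proof.
elim/quotW: x => s; rewrite (tensor_scaleE b s) !tensor_scaleE.
by apply/tensor_eqP; apply: tc_scaleA.
Qed.
Lemma tensor_scale1 : left_id 1 tensor_scale.
Proof.
by elim/quotW=> s; rewrite !tensor_scaleE; apply/tensor_eqP; apply: tc_scale1.
Qed.
Lemma tensor_scaleDr : right_distributive tensor_scale +%R.
Proof.
move=> a; elim/quotW=> s; elim/quotW=> t.
rewrite [_ + _](tensor_addE s t) (tensor_scaleE a s) (tensor_scaleE a t).
rewrite tensor_scaleE [RHS]tensor_addE.
by apply/tensor_eqP; apply: tc_scaleDr.
Qed.
Lemma tensor_scaleDl x : {morph tensor_scale^~ x : a b / a + b}.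
Proof.
move=> a b; elim/quotW: x => s /=.
rewrite (tensor_scaleE a s) (tensor_scaleE b s) tensor_scaleE [RHS]tensor_addE.
by apply/tensor_eqP; apply: tc_scaleDl.
Qed.

HB.instance Definition _ := GRing.Zmodule_isLmodule.Build K tensor
  tensor_scaleA tensor_scale1 tensor_scaleDr tensor_scaleDl.

Lemma tensDl u u' v : tens (u + u') v = tens u v + tens u' v.
Proof. by rewrite [RHS]tensor_addE; apply/tensor_eqP; apply: tc_pureDl. Qed.
Lemma tensDr u v v' : tens u (v + v') = tens u v + tens u v'.
Proof. by rewrite [RHS]tensor_addE; apply/tensor_eqP; apply: tc_pureDr. Qed.
Lemma tensZl a u v : tens (a *: u) v = a *: tens u v.
Proof. by rewrite [RHS]tensor_scaleE; apply/tensor_eqP; apply: tc_pureZl. Qed.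
Lemma tensZr a u v : tens u (a *: v) = a *: tens u v.
Proof. by rewrite [RHS]tensor_scaleE; apply/tensor_eqP; apply: tc_pureZr. Qed.

Lemma tensor_ind (P : tensor -> Prop) :
  (forall u v, P (tens u v)) -> P 0 ->
  (forall x y, P x -> P y -> P (x + y)) -> (forall a x, P x -> P (a *: x)) ->
  forall x, P x.
Proof.
move=> Ppure P0 PD PZ; elim/quotW; elim=> [u v||s IHs t IHt|a s IHs] //.
- exact: Ppure.
- by have := PD _ _ IHs IHt; rewrite [_ + _]tensor_addE.
- by have := PZ a _ IHs; rewrite [_ *: _]tensor_scaleE.
Qed.

Definition bilinear_map (W : lmodType K) (f : U -> V -> W) : Prop :=
  (forall v, linear (f^~ v)) /\ (forall u, linear (f u)).

Fixpoint tterm_eval (W : lmodType K) (f : U -> V -> W) (s : tterm) : W :=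
  match s with
  | TPure u v => f u v
  | TZero => 0
  | TAdd s t => tterm_eval f s + tterm_eval f t
  | TScale a s => a *: tterm_eval f s
  end.

(* Meaningful only when f is bilinear: otherwise the value depends on the
   chosen representative. *)
Definition tlift (W : lmodType K) (f : U -> V -> W) (x : tensor) : W :=
  tterm_eval f (repr x).

Section Lift.
Variables (W : lmodType K) (f : U -> V -> W).
Hypothesis fbil : bilinear_map f.

Lemma tterm_eval_cong s t : tcong s t -> tterm_eval f s = tterm_eval f t.
Proof.
have [fl fr] := fbil.
have flD u u' v : f (u + u') v = f u v + f u' v.
  by have := fl v 1 u u'; rewrite !scale1r.
have frD u v v' : f u (v + v') = f u v + f u v'.
  by have := fr u 1 v v'; rewrite !scale1r.
have fl0 v : f 0 v = 0.
  by apply: (addrI (f 0 v)); rewrite -flD !addr0.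
have fr0 u : f u 0 = 0.
  by apply: (addrI (f u 0)); rewrite -frD !addr0.
elim=> /= {s t}.
- by [].
- by move=> s t _ ->.
- by move=> s t r _ -> _ ->.
- by move=> s s' t t' _ -> _ ->.
- by move=> c s s' _ ->.
- by move=> *; rewrite addrA.
- by move=> *; rewrite addrC.
- by move=> *; rewrite add0r.
- by move=> *; rewrite scale0r.
- by move=> *; rewrite scale1r.
- by move=> *; rewrite scalerA.
- by move=> *; rewrite scalerDr.
- by move=> *; rewrite scalerDl.
- by [].
- by [].
- by move=> a u v; have := fl v a u 0; rewrite addr0 fl0 addr0.
- by move=> a u v; have := fr u a v 0; rewrite addr0 fr0 addr0.
Qed.

Lemma tlift_pi s : tlift f (\pi_tensor s) = tterm_eval f s.
Proof. by apply: tterm_eval_cong; apply: tensor_reprP. Qed.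

Lemma tliftE u v : tlift f (tens u v) = f u v.
Proof. exact: tlift_pi. Qed.

Lemma tlift_linear : linear (tlift f).
Proof.
move=> a; elim/quotW=> s; elim/quotW=> t.
by rewrite [a *: _]tensor_scaleE [_ + _]tensor_addE !tlift_pi.
Qed.

End Lift.

End Tensor.

Notation "U ⊗ V" := (tensor U V).
Notation "u ⊗: v" := (tens u v).

Section TensorMaps.
Variable K : fieldType.
Implicit Types U V W X : lmodType K.

Lemma linear_eq_tens U V W (f g : {linear U ⊗ V -> W}) :
  (forall u v, f (u ⊗: v) = g (u ⊗: v)) -> f =1 g.
Proof.
move=> fg; elim/tensor_ind => // [|x y hx hy|a x hx].
- by rewrite !linear0.
- by rewrite !linearD hx hy.
- by rewrite !linearZ hx.
Qed.

Definition tmap U U' V V' (f : U -> U') (g : V -> V') : U ⊗ V -> U' ⊗ V' :=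
  tlift (fun u v => f u ⊗: g v).

Section TmapLinear.
Variables (U U' V V' : lmodType K) (f : {linear U -> U'}) (g : {linear V -> V'}).
Lemma tmap_bil : bilinear_map (fun u v => f u ⊗: g v).
Proof.
by split=> [v|u] a x y; rewrite linearP ?tensDl ?tensDr ?tensZl ?tensZr.
Qed.
Lemma tmapE u v : tmap f g (u ⊗: v) = f u ⊗: g v.
Proof. exact: (tliftE tmap_bil). Qed.
HB.instance Definition _ := GRing.isLinear.Build K (U ⊗ V) (U' ⊗ V') _
  (tmap f g) (tlift_linear tmap_bil).
End TmapLinear.

Definition tflip U V : U ⊗ V -> V ⊗ U := tlift (fun u v => v ⊗: u).

Section TflipLinear.
Variables (U V : lmodType K).
Lemma tflip_bil : bilinear_map (fun (u : U) (v : V) => v ⊗: u).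
Proof. by split=> [v|u] a x y; rewrite ?tensDl ?tensDr ?tensZl ?tensZr. Qed.
Lemma tflipE (u : U) (v : V) : tflip (u ⊗: v) = v ⊗: u.
Proof. exact: (tliftE tflip_bil). Qed.
HB.instance Definition _ := GRing.isLinear.Build K (U ⊗ V) (V ⊗ U) _
  (@tflip U V) (tlift_linear tflip_bil).
End TflipLinear.

Section Assoc.
Variables (U V W : lmodType K).

Definition tassoc1 (w : W) : U ⊗ V -> U ⊗ (V ⊗ W) :=
  tlift (fun u v => u ⊗: (v ⊗: w)).

Lemma tassoc1_bil (w : W) :
  bilinear_map (fun (u : U) (v : V) => u ⊗: (v ⊗: w)).
Proof. by split=> [v|u] a x y; rewrite ?(tensDl, tensDr, tensZl, tensZr). Qed.
HB.instance Definition _ w := GRing.isLinear.Build K (U ⊗ V) (U ⊗ (V ⊗ W)) _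
  (tassoc1 w) (tlift_linear (tassoc1_bil w)).

Definition tassoc : (U ⊗ V) ⊗ W -> U ⊗ (V ⊗ W) :=
  tlift (fun x w => tassoc1 w x).

Lemma tassoc_bil : bilinear_map (fun x w => tassoc1 w x).
Proof.
split=> [w|x a w w']; first exact: linearP.
elim/tensor_ind: x => [u v||x y hx hy|b x hx].
- by rewrite /tassoc1 !(tliftE (tassoc1_bil _)) !(tensDr, tensZr).
- by rewrite !linear0 addr0.
- by rewrite !linearD /= hx hy addrACA.
- by rewrite !linearZ /= hx scalerDr.
Qed.
HB.instance Definition _ := GRing.isLinear.Build K ((U ⊗ V) ⊗ W)
  (U ⊗ (V ⊗ W)) _ tassoc (tlift_linear tassoc_bil).

Lemma tassocE u v w : tassoc ((u ⊗: v) ⊗: w) = u ⊗: (v ⊗: w).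
Proof.
by rewrite /tassoc (tliftE tassoc_bil) /tassoc1 (tliftE (tassoc1_bil w)).
Qed.

Definition tassocV1 (u : U) : V ⊗ W -> (U ⊗ V) ⊗ W :=
  tlift (fun v w => (u ⊗: v) ⊗: w).

Lemma tassocV1_bil (u : U) :
  bilinear_map (fun (v : V) (w : W) => (u ⊗: v) ⊗: w).
Proof. by split=> [w|v] a x y; rewrite ?(tensDl, tensDr, tensZl, tensZr). Qed.
HB.instance Definition _ u := GRing.isLinear.Build K (V ⊗ W) ((U ⊗ V) ⊗ W) _
  (tassocV1 u) (tlift_linear (tassocV1_bil u)).

Definition tassocV : U ⊗ (V ⊗ W) -> (U ⊗ V) ⊗ W := tlift tassocV1.

Lemma tassocV_bil : bilinear_map tassocV1.
Proof.
split=> [x a u u'|u]; last exact: linearP.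
elim/tensor_ind: x => [v w||x y hx hy|b x hx].
- by rewrite /tassocV1 !(tliftE (tassocV1_bil _)) !(tensDl, tensZl).
- by rewrite !linear0 addr0.
- by rewrite !linearD /= hx hy addrACA.
- by rewrite !linearZ /= hx scalerDr.
Qed.
HB.instance Definition _ := GRing.isLinear.Build K (U ⊗ (V ⊗ W))
  ((U ⊗ V) ⊗ W) _ tassocV (tlift_linear tassocV_bil).

Lemma tassocVE u v w : tassocV (u ⊗: (v ⊗: w)) = (u ⊗: v) ⊗: w.
Proof.
by rewrite /tassocV (tliftE tassocV_bil) /tassocV1 (tliftE (tassocV1_bil u)).
Qed.

End Assoc.

Definition tunitl V : K^o ⊗ V -> V := tlift (fun (a : K^o) v => a *: v).
Definition tunitr V : V ⊗ K^o -> V := tlift (fun v (a : K^o) => a *: v).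

Section TunitLinear.
Variable V : lmodType K.
Lemma tunitl_bil : bilinear_map (fun (a : K^o) (v : V) => a *: v).
Proof.
split=> [v|u] a x y; first by rewrite scalerDl scalerA.
by rewrite scalerDr !scalerA mulrC.
Qed.
Lemma tunitlE (a : K^o) (v : V) : tunitl (a ⊗: v) = a *: v.
Proof. exact: (tliftE tunitl_bil). Qed.
HB.instance Definition _ := GRing.isLinear.Build K (K^o ⊗ V) V _
  (@tunitl V) (tlift_linear tunitl_bil).
Lemma tunitr_bil : bilinear_map (fun (v : V) (a : K^o) => a *: v).
Proof.
split=> [v|u] a x y; last by rewrite scalerDl scalerA.
by rewrite scalerDr !scalerA mulrC.
Qed.
Lemma tunitrE (v : V) (a : K^o) : tunitr (v ⊗: a) = a *: v.
Proof. exact: (tliftE tunitr_bil). Qed.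
HB.instance Definition _ := GRing.isLinear.Build K (V ⊗ K^o) V _
  (@tunitr V) (tlift_linear tunitr_bil).
End TunitLinear.

Definition tmul (B : algType K) : B ⊗ B -> B := tlift (fun a b : B => a * b).

Section TmulLinear.
Variable B : algType K.
Lemma tmul_bil : bilinear_map (fun a b : B => a * b).
Proof.
split=> [b|b] a x y; first by rewrite mulrDl scalerAl.
by rewrite mulrDr scalerAr.
Qed.
Lemma tmulE (a b : B) : tmul (a ⊗: b) = a * b.
Proof. exact: (tliftE tmul_bil). Qed.
HB.instance Definition _ := GRing.isLinear.Build K (B ⊗ B) B _
  (@tmul B) (tlift_linear tmul_bil).
End TmulLinear.

(* f ⊗ id on a right-nested triple tensor product, id ⊗ f on a left-nested
   one, and id ⊗ f ⊗ id on a fourfold one. *)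
Section Leg.
Variables (U V W X Y Z : lmodType K).

Definition tfst (f : {linear U ⊗ V -> X ⊗ Y}) :
    {linear U ⊗ (V ⊗ W) -> X ⊗ (Y ⊗ W)} :=
  @tassoc X Y W \o tmap f idfun \o @tassocV U V W.

Definition tsnd (f : {linear V ⊗ W -> X ⊗ Y}) :
    {linear (U ⊗ V) ⊗ W -> (U ⊗ X) ⊗ Y} :=
  @tassocV U X Y \o tmap idfun f \o @tassoc U V W.

End Leg.

Definition tmid (U V W X Y Z : lmodType K) (f : {linear V ⊗ W -> X ⊗ Y}) :
    {linear (U ⊗ V) ⊗ (W ⊗ Z) -> (U ⊗ X) ⊗ (Y ⊗ Z)} :=
  @tassocV U X (Y ⊗ Z) \o tmap idfun (@tfst V W Z X Y f) \o @tassoc U V (W ⊗ Z).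

End TensorMaps.

Arguments tfst {K U V W X Y} f.
Arguments tsnd {K U V W X Y} f.
Arguments tmid {K U V W X Y Z} f.

(** * Unital associative algebras presented by generators and relations:
    expressions in the generators modulo the congruence generated by the
    algebra axioms and the relations *)

Section Presented.
Variables (K : fieldType) (X : Type).

Inductive pterm : Type :=
| PVar of X
| PConst of K
| PAdd of pterm & pterm
| PMul of pterm & pterm.

Variable rel : pterm -> pterm -> Prop.

Inductive pcong : pterm -> pterm -> Prop :=
| pc_refl s : pcong s s
| pc_sym s t : pcong s t -> pcong t s
| pc_trans s t r : pcong s t -> pcong t r -> pcong s r
| pc_add s s' t t' : pcong s s' -> pcong t t' -> pcong (PAdd s t) (PAdd s' t')
| pc_mul s s' t t' : pcong s s' -> pcong t t' -> pcong (PMul s t) (PMul s' t')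
| pc_addA s t r : pcong (PAdd s (PAdd t r)) (PAdd (PAdd s t) r)
| pc_addC s t : pcong (PAdd s t) (PAdd t s)
| pc_add0 s : pcong (PAdd (PConst 0) s) s
| pc_mulA s t r : pcong (PMul s (PMul t r)) (PMul (PMul s t) r)
| pc_mul0 s : pcong (PMul (PConst 0) s) (PConst 0)
| pc_mul1 s : pcong (PMul (PConst 1) s) s
| pc_mulDl s t r : pcong (PMul (PAdd s t) r) (PAdd (PMul s r) (PMul t r))
| pc_mulDr s t r : pcong (PMul s (PAdd t r)) (PAdd (PMul s t) (PMul s r))
| pc_constD a b : pcong (PConst (a + b)) (PAdd (PConst a) (PConst b))
| pc_constM a b : pcong (PConst (a * b)) (PMul (PConst a) (PConst b))
| pc_constC a s : pcong (PMul (PConst a) s) (PMul s (PConst a))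
| pc_rel s t : rel s t -> pcong s t.

Fixpoint pterm_eval (B : algType K) (f : X -> B) (s : pterm) : B :=
  match s with
  | PVar x => f x
  | PConst a => a%:A
  | PAdd s t => pterm_eval f s + pterm_eval f t
  | PMul s t => pterm_eval f s * pterm_eval f t
  end.

Definition satisfies_rel (B : algType K) (f : X -> B) : Prop :=
  forall s t, rel s t -> pterm_eval f s = pterm_eval f t.

Lemma pterm_eval_cong (B : algType K) (f : X -> B) s t :
  satisfies_rel f -> pcong s t -> pterm_eval f s = pterm_eval f t.
Proof.
move=> frel; elim=> /= {s t}.
- by [].
- by move=> s t _ ->.
- by move=> s t r _ -> _ ->.
- by move=> s s' t t' _ -> _ ->.
- by move=> s s' t t' _ -> _ ->.
- by move=> *; rewrite addrA.
- by move=> *; rewrite addrC.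
- by move=> *; rewrite scale0r add0r.
- by move=> *; rewrite mulrA.
- by move=> *; rewrite scale0r mul0r.
- by move=> *; rewrite scale1r mul1r.
- by move=> *; rewrite mulrDl.
- by move=> *; rewrite mulrDr.
- by move=> *; rewrite scalerDl.
- by move=> *; rewrite -scalerAl mul1r scalerA.
- by move=> *; rewrite -scalerAl mul1r -scalerAr mulr1.
- exact: frel.
Qed.

HB.instance Definition _ := gen_eqMixin pterm.
HB.instance Definition _ := gen_choiceMixin pterm.

Definition pcongb : ssrbool.rel pterm := fun s t => `[< pcong s t >].

Lemma pcongb_refl : reflexive pcongb.
Proof. by move=> s; apply/asboolP; apply: pc_refl. Qed.
Lemma pcongb_sym : symmetric pcongb.
Proof. by move=> s t; apply/asboolP/asboolP; apply: pc_sym. Qed.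
Lemma pcongb_trans : transitive pcongb.
Proof. by move=> t s r /asboolP h /asboolP k; apply/asboolP; apply: pc_trans k. Qed.

Canonical pcong_equiv := EquivRel pcongb pcongb_refl pcongb_sym pcongb_trans.

Definition presalg : Type := {eq_quot pcong_equiv}.
HB.instance Definition _ := Choice.on presalg.
HB.instance Definition _ := EqQuotient.on presalg.

Definition pgen (x : X) : presalg := \pi_presalg (PVar x).

Lemma presalg_eqP (s t : pterm) : \pi_presalg s = \pi_presalg t <-> pcong s t.
Proof. by split=> [/eqmodP /asboolP|h]; last by apply/eqmodP/asboolP. Qed.

Lemma presalg_reprP (s : pterm) : pcong (repr (\pi_presalg s)) s.
Proof. by apply/presalg_eqP; rewrite reprK. Qed.

Definition presalg_const (a : K) : presalg := \pi_presalg (PConst a).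
Definition presalg_add (x y : presalg) : presalg :=
  \pi_presalg (PAdd (repr x) (repr y)).
Definition presalg_mul (x y : presalg) : presalg :=
  \pi_presalg (PMul (repr x) (repr y)).
Definition presalg_opp (x : presalg) : presalg :=
  presalg_mul (presalg_const (-1)) x.
Definition presalg_scale (a : K) (x : presalg) : presalg :=
  presalg_mul (presalg_const a) x.

Lemma presalg_addE s t :
  presalg_add (\pi_presalg s) (\pi_presalg t) = \pi_presalg (PAdd s t).
Proof. by apply/presalg_eqP; apply: pc_add; apply: presalg_reprP. Qed.
Lemma presalg_mulE s t :
  presalg_mul (\pi_presalg s) (\pi_presalg t) = \pi_presalg (PMul s t).
Proof. by apply/presalg_eqP; apply: pc_mul; apply: presalg_reprP. Qed.

Lemma presalg_addA : associative presalg_add.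
Proof.
elim/quotW=> s; elim/quotW=> t; elim/quotW=> r.
rewrite (presalg_addE t r) (presalg_addE s t) !presalg_addE.
by apply/presalg_eqP; apply: pc_addA.
Qed.
Lemma presalg_addC : commutative presalg_add.
Proof.
elim/quotW=> s; elim/quotW=> t; rewrite !presalg_addE.
by apply/presalg_eqP; apply: pc_addC.
Qed.
Lemma presalg_add0 : left_id (presalg_const 0) presalg_add.
Proof.
by elim/quotW=> s; rewrite presalg_addE; apply/presalg_eqP; apply: pc_add0.
Qed.
Lemma presalg_addN : left_inverse (presalg_const 0) presalg_opp presalg_add.
Proof.
elim/quotW=> s; rewrite /presalg_opp presalg_mulE presalg_addE.
apply/presalg_eqP; apply: pc_trans (pc_mul0 s); apply: pc_sym.
apply: pc_trans (_ : pcong _ (PMul (PAdd (PConst (-1)) (PConst 1)) s)) _.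
  by apply: pc_mul (pc_refl _); rewrite -(addNr 1); apply: pc_constD.
apply: pc_trans (pc_mulDl _ _ _) _; exact: pc_add (pc_refl _) (pc_mul1 _).
Qed.

HB.instance Definition _ := GRing.isZmodule.Build presalg
  presalg_addA presalg_addC presalg_add0 presalg_addN.

Lemma presalg_mulA : associative presalg_mul.
Proof.
elim/quotW=> s; elim/quotW=> t; elim/quotW=> r.
rewrite (presalg_mulE t r) (presalg_mulE s t) !presalg_mulE.
by apply/presalg_eqP; apply: pc_mulA.
Qed.
Lemma presalg_mul1 : left_id (presalg_const 1) presalg_mul.
Proof.
by elim/quotW=> s; rewrite presalg_mulE; apply/presalg_eqP; apply: pc_mul1.
Qed.
Lemma presalg_constC a : forall x,
  presalg_mul (presalg_const a) x = presalg_mul x (presalg_const a).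
Proof.
by elim/quotW=> s; rewrite !presalg_mulE; apply/presalg_eqP; apply: pc_constC.
Qed.
Lemma presalg_mulr1 : right_id (presalg_const 1) presalg_mul.
Proof. by move=> x; rewrite -presalg_constC presalg_mul1. Qed.
Lemma presalg_mulDl : left_distributive presalg_mul +%R.
Proof.
elim/quotW=> s; elim/quotW=> t; elim/quotW=> r.
rewrite [s in presalg_mul s _ = _](presalg_addE s t) (presalg_mulE s r).
rewrite (presalg_mulE t r) presalg_mulE [RHS]presalg_addE.
by apply/presalg_eqP; apply: pc_mulDl.
Qed.
Lemma presalg_mulDr : right_distributive presalg_mul +%R.
Proof.
elim/quotW=> s; elim/quotW=> t; elim/quotW=> r.
rewrite [s in presalg_mul _ s = _](presalg_addE t r) (presalg_mulE s r).
rewrite (presalg_mulE s t) presalg_mulE [RHS]presalg_addE.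
by apply/presalg_eqP; apply: pc_mulDr.
Qed.

HB.instance Definition _ := GRing.Zmodule_isPzRing.Build presalg
  presalg_mulA presalg_mul1 presalg_mulr1 presalg_mulDl presalg_mulDr.

Lemma presalg_constD a b :
  presalg_const (a + b) = presalg_const a + presalg_const b.
Proof. by rewrite [RHS]presalg_addE; apply/presalg_eqP; apply: pc_constD. Qed.
Lemma presalg_constM a b :
  presalg_const (a * b) = presalg_mul (presalg_const a) (presalg_const b).
Proof. by rewrite presalg_mulE; apply/presalg_eqP; apply: pc_constM. Qed.

Lemma presalg_scaleA a b x :
  presalg_scale a (presalg_scale b x) = presalg_scale (a * b) x.
Proof. by rewrite /presalg_scale presalg_mulA -presalg_constM. Qed.
Lemma presalg_scale1 : left_id 1 presalg_scale.
Proof. exact: presalg_mul1. Qed.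
Lemma presalg_scaleDr : right_distributive presalg_scale +%R.
Proof. by move=> a x y; apply: presalg_mulDr. Qed.
Lemma presalg_scaleDl x : {morph presalg_scale^~ x : a b / a + b}.
Proof. by move=> a b; rewrite /presalg_scale presalg_constD presalg_mulDl. Qed.

HB.instance Definition _ := GRing.Zmodule_isLmodule.Build K presalg
  presalg_scaleA presalg_scale1 presalg_scaleDr presalg_scaleDl.

Lemma presalg_scaleAl (a : K) (x y : presalg) : a *: (x * y) = (a *: x) * y.
Proof. exact: presalg_mulA. Qed.
Lemma presalg_scaleAr (a : K) (x y : presalg) : a *: (x * y) = x * (a *: y).
Proof.
rewrite presalg_scaleAl; transitivity (x * presalg_const a * y).
  by congr (_ * y); apply: presalg_constC.
by rewrite -mulrA.
Qed.

Lemma presalg_nontrivial (B : algType K) (f : X -> B) :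
  satisfies_rel f -> 1 != 0 :> presalg.
Proof.
move=> frel; apply/eqP => /presalg_eqP /(pterm_eval_cong frel) /= /eqP.
by rewrite scale1r scale0r oner_eq0.
Qed.

Lemma presalg_ind (P : presalg -> Prop) :
  (forall x, P (pgen x)) -> P 1 ->
  (forall x y, P x -> P y -> P (x + y)) ->
  (forall x y, P x -> P y -> P (x * y)) ->
  (forall a x, P x -> P (a *: x)) -> forall x, P x.
Proof.
move=> Pgen P1 PD PM PZ; elim/quotW; elim=> [x|a|s IHs t IHt|s IHs t IHt].
- exact: Pgen.
- by have := PZ a _ P1; rewrite [_ *: _]presalg_constC presalg_mul1.
- by have := PD _ _ IHs IHt; rewrite [_ + _]presalg_addE.
- by have := PM _ _ IHs IHt; rewrite [_ * _]presalg_mulE.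
Qed.

(* The grading in which the generator x has degree d x: homog n is its
   degree-n component. *)
Inductive homog (d : X -> int) : int -> presalg -> Prop :=
| homog_gen x : homog d (d x) (pgen x)
| homog_one : homog d 0 1
| homog_mul m n x y : homog d m x -> homog d n y -> homog d (m + n) (x * y)
| homog_zero n : homog d n 0
| homog_add n x y : homog d n x -> homog d n y -> homog d n (x + y)
| homog_scale n a x : homog d n x -> homog d n (a *: x).

End Presented.

Notation "s + t" := (PAdd s t) : pterm_scope.
Notation "s * t" := (PMul s t) : pterm_scope.
Notation "a *: s" := (PMul (PConst _ a%R) s) : pterm_scope.
Notation "s - t" := (PAdd s (PMul (PConst _ (-1)%R) t)) : pterm_scope.
Notation "1" := (PConst _ 1%R) : pterm_scope.

Section Braided.
Variable K : fieldType.

(* Compatibility of a braiding with the product, respectively the coproduct,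
   of its left (l) or right (r) argument. *)
Section BraidingAxioms.
Variables (B : algType K) (V : lmodType K).

Definition braid_mull (Xi : {linear B ⊗ V -> V ⊗ B}) : Prop :=
  Xi \o tmap (@tmul K B) idfun =1
  tmap idfun (@tmul K B) \o @tassoc K V B B \o tmap Xi idfun \o tsnd Xi.

Definition braid_mulr (Xi : {linear V ⊗ B -> B ⊗ V}) : Prop :=
  Xi \o tmap idfun (@tmul K B) =1
  tmap (@tmul K B) idfun \o @tassocV K B B V \o tmap idfun Xi \o tfst Xi.

Variable Delta : {linear B -> B ⊗ B}.

Definition braid_comull (Xi : {linear B ⊗ V -> V ⊗ B}) : Prop :=
  tmap idfun Delta \o Xi =1
  @tassoc K V B B \o tmap Xi idfun \o tsnd Xi \o tmap Delta idfun.

Definition braid_comulr (Xi : {linear V ⊗ B -> B ⊗ V}) : Prop :=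
  tmap Delta idfun \o Xi =1
  @tassocV K B B V \o tmap idfun Xi \o tfst Xi \o tmap idfun Delta.

End BraidingAxioms.

Record braidedHopf (B : algType K) := BraidedHopf {
  bpsi : {linear B ⊗ B -> B ⊗ B};
  bdelta : {linear B -> B ⊗ B};
  beps : {linear B -> K^o};
  bantip : {linear B -> B};
  bpsi_bij : bijective bpsi;
  bpsi_braid : tmap bpsi idfun \o tsnd bpsi \o tmap bpsi idfun =1
               tsnd bpsi \o tmap bpsi idfun \o tsnd bpsi;
  bpsi_mull : braid_mull bpsi;
  bpsi_mulr : braid_mulr bpsi;
  bpsi_onel : forall b, bpsi (1 ⊗: b) = b ⊗: 1;
  bpsi_oner : forall b, bpsi (b ⊗: 1) = 1 ⊗: b;
  bpsi_comull : braid_comull bdelta bpsi;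
  bpsi_comulr : braid_comulr bdelta bpsi;
  bpsi_epsl : @tunitr K B \o tmap idfun beps \o bpsi =1
              @tunitl K B \o tmap beps idfun;
  bpsi_epsr : @tunitl K B \o tmap beps idfun \o bpsi =1
              @tunitr K B \o tmap idfun beps;
  bdelta_coassoc : @tassoc K B B B \o tmap bdelta idfun \o bdelta =1
                   tmap idfun bdelta \o bdelta;
  bdelta_epsl : @tunitl K B \o tmap beps idfun \o bdelta =1 idfun;
  bdelta_epsr : @tunitr K B \o tmap idfun beps \o bdelta =1 idfun;
  bdelta_one : bdelta 1 = 1 ⊗: 1;
  (* the product of B ⊗ B is (a ⊗ b)(c ⊗ d) = a Ψ(b ⊗ c) d *)
  bdelta_mul : bdelta \o @tmul K B =1
    tmap (@tmul K B) (@tmul K B) \o tmid bpsi \o tmap bdelta bdelta;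
  beps_one : beps 1 = 1;
  beps_mul : forall a b, beps (a * b) = beps a * beps b;
  bantip_l : @tmul K B \o tmap bantip idfun \o bdelta =1 (fun b => (beps b)%:A);
  bantip_r : @tmul K B \o tmap idfun bantip \o bdelta =1 (fun b => (beps b)%:A)
}.

Section Actions.
Variables (H A : algType K) (HH : braidedHopf H).

Record braided_pairing (HA : braidedHopf A) (Xi : {linear H ⊗ A -> A ⊗ H})
    (p : {linear H ⊗ A -> K^o}) : Prop := BraidedPairing {
  pair_mulr : p \o tmap idfun (@tmul K A) =1
    @tunitl K K^o \o tmap p p \o tmid Xi \o tmap (bdelta HH) idfun;
  pair_mull : p \o tmap (@tmul K H) idfun =1
    @tunitl K K^o \o tmap p p \o tmid Xi \o tmap idfun (bdelta HA);
  pair_antip : p \o tmap (bantip HH) idfun =1 p \o tmap idfun (bantip HA);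
  pair_onel : forall a, p (1 ⊗: a) = beps HA a;
  pair_oner : forall h, p (h ⊗: 1) = beps HH h
}.

Record left_braided_module_algebra (Xi : {linear H ⊗ A -> A ⊗ H})
    (act : {linear H ⊗ A -> A}) : Prop := LeftBraidedModuleAlgebra {
  lbraid_mulH : braid_mull Xi;
  lbraid_mulA : braid_mulr Xi;
  lbraid_comulH : braid_comull (bdelta HH) Xi;
  lact_mulA : act \o tmap idfun (@tmul K A) =1
    @tmul K A \o tmap act act \o tmid Xi \o tmap (bdelta HH) idfun;
  lact_mulH : act \o tmap (@tmul K H) idfun =1
    act \o tmap idfun act \o @tassoc K H H A;
  lact_braid : Xi \o tmap idfun act =1
    tmap act idfun \o @tassocV K H A H \o tmap idfun Xi \o tfst (bpsi HH);
  lact_one : forall a, act (1 ⊗: a) = a;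
  lact_eps : forall h, act (h ⊗: 1) = (beps HH h)%:A
}.

Record right_braided_action (Xi : {linear A ⊗ H -> H ⊗ A})
    (act : {linear A ⊗ H -> A}) : Prop := RightBraidedAction {
  rbraid_mulH : braid_mulr Xi;
  rbraid_mulA : braid_mull Xi;
  rbraid_comulH : braid_comulr (bdelta HH) Xi;
  ract_mulA : act \o tmap (@tmul K A) idfun =1
    @tmul K A \o tmap act act \o tmid Xi \o tmap idfun (bdelta HH);
  ract_mulH : act \o tmap idfun (@tmul K H) =1
    act \o tmap act idfun \o @tassocV K A H H;
  ract_braid : Xi \o tmap act idfun =1
    tmap idfun act \o @tassoc K H A H \o tmap Xi idfun \o tsnd (bpsi HH);
  ract_one : forall a, act (a ⊗: 1) = a;
  ract_eps : forall h, act (1 ⊗: h) = (beps HH h)%:A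
}.

(* h ▷ x = (id ⊗ p)(Xi ⊗ id)(id ⊗ Δ)(h ⊗ x) *)
Definition left_action (HA : braidedHopf A) (Xi : {linear H ⊗ A -> A ⊗ H})
    (p : {linear H ⊗ A -> K^o}) : {linear H ⊗ A -> A} :=
  @tunitr K A \o tmap idfun p \o tfst Xi \o tmap idfun (bdelta HA).

(* x ◁ h = (p ⊗ id)(id ⊗ Xi)(Δ ⊗ id)(x ⊗ h) *)
Definition right_action (HA : braidedHopf A) (Xi : {linear A ⊗ H -> H ⊗ A})
    (p : {linear A ⊗ H -> K^o}) : {linear A ⊗ H -> A} :=
  @tunitl K A \o tmap p idfun \o tsnd Xi \o tmap (bdelta HA) idfun.

End Actions.
End Braided.

(* SU2 is SU_{q,φ}(2) and U2 is U_{q,φ}(û(2)). The suffix S (a prime in the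
   short notations) marks the starred generators, which are treated as
   generators in their own right, and V marks inverses. The involution itself
   is not used. *)

Section QuantumAlgebras.
Variables (R : realType) (q phi : R).
Local Notation C := R[i].

(* cexpi t = e^{it}, so that E n below is e^{inφ} *)
Definition cexpi (t : R) : C := (cos t +i* sin t)%C.

Local Notation Q := ((q%:C)%C : C).
Local Notation E n := (cexpi (n%:~R * phi)).

Inductive SU_gen := Alpha | Gamma | AlphaS | GammaS.

Section SURelations.
Local Notation a := (PVar C Alpha).
Local Notation a' := (PVar C AlphaS).
Local Notation c := (PVar C Gamma).
Local Notation c' := (PVar C GammaS).

Inductive SU_rel : pterm C SU_gen -> pterm C SU_gen -> Prop :=
| SU_ac   : SU_rel (a * c)%pterm ((Q * E 4) *: (c * a))%pterm
| SU_ac'  : SU_rel (a * c')%pterm ((Q * E (-4)) *: (c' * a))%pterm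
| SU_ca'  : SU_rel (c * a')%pterm ((Q * E 4) *: (a' * c))%pterm
| SU_c'a' : SU_rel (c' * a')%pterm ((Q * E (-4)) *: (a' * c'))%pterm
| SU_aa'  : SU_rel (a * a' + Q ^+ 2 *: (c' * c))%pterm 1%pterm
| SU_a'a  : SU_rel (a' * a + c * c')%pterm 1%pterm
| SU_cc'  : SU_rel (c * c')%pterm (c' * c)%pterm.
End SURelations.

Inductive U_gen := Ee | Ff | Kk | KkS | KkV | KkSV.

Section URelations.
Local Notation e := (PVar C Ee).
Local Notation f := (PVar C Ff).
Local Notation k := (PVar C Kk).
Local Notation k' := (PVar C KkS).
Local Notation kV := (PVar C KkV).
Local Notation k'V := (PVar C KkSV).

Inductive U_rel : pterm C U_gen -> pterm C U_gen -> Prop :=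
| U_kkV   : U_rel (k * kV)%pterm 1%pterm
| U_kVk   : U_rel (kV * k)%pterm 1%pterm
| U_k'k'V : U_rel (k' * k'V)%pterm 1%pterm
| U_k'Vk' : U_rel (k'V * k')%pterm 1%pterm
| U_ek    : U_rel (e * k)%pterm ((Q * E (-4)) *: (k * e))%pterm
| U_kf    : U_rel (k * f)%pterm ((Q * E (-4)) *: (f * k))%pterm
| U_k'f   : U_rel (k' * f)%pterm ((Q * E 4) *: (f * k'))%pterm
| U_ek'   : U_rel (e * k')%pterm ((Q * E 4) *: (k' * e))%pterm
| U_kk'   : U_rel (k * k')%pterm (k' * k)%pterm
| U_ef    : U_rel (e * f - f * e)%pterm ((1 / (Q^-1 - Q)) *: (k * k' - kV * k'V))%pterm.
End URelations.

Definition SU2 : Type := presalg SU_rel.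
Definition U2 : Type := presalg U_rel.

HB.instance Definition _ := GRing.PzRing.on SU2.
HB.instance Definition _ := GRing.Lmodule.on SU2.
HB.instance Definition _ := GRing.PzRing.on U2.
HB.instance Definition _ := GRing.Lmodule.on U2.

Definition SU_eps (x : SU_gen) : C^o :=
  match x with Alpha | AlphaS => 1 | Gamma | GammaS => 0 end.
Definition U_eps (x : U_gen) : C^o :=
  match x with Ee | Ff => 0 | Kk | KkS | KkV | KkSV => 1 end.

Lemma SU_epsP : satisfies_rel SU_rel SU_eps.
Proof.
move=> s t; case=> /=;
  by rewrite ?(mulr0, mul0r, mulr1, addr0, scale1r).
Qed.
Lemma U_epsP : satisfies_rel U_rel U_eps.
Proof.
move=> s t; case=> /=;
  by rewrite ?(mulr0, mul0r, mulr1, mul1r, scaler0, addr0, add0r, scaleN1r,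
               scale1r, subrr, oppr0).
Qed.

HB.instance Definition _ :=
  GRing.PzSemiRing_isNonZero.Build SU2 (presalg_nontrivial SU_epsP).
HB.instance Definition _ :=
  GRing.PzSemiRing_isNonZero.Build U2 (presalg_nontrivial U_epsP).
HB.instance Definition _ := GRing.Lmodule_isLalgebra.Build C SU2
  (@presalg_scaleAl _ _ SU_rel).
HB.instance Definition _ := GRing.Lmodule_isLalgebra.Build C U2
  (@presalg_scaleAl _ _ U_rel).
HB.instance Definition _ := GRing.Lalgebra_isAlgebra.Build C SU2
  (@presalg_scaleAr _ _ SU_rel).
HB.instance Definition _ := GRing.Lalgebra_isAlgebra.Build C U2
  (@presalg_scaleAr _ _ U_rel).

Definition gSU (x : SU_gen) : SU2 := pgen SU_rel x.
Definition gU (x : U_gen) : U2 := pgen U_rel x.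

Definition SU_deg (x : SU_gen) : int :=
  match x with Alpha | AlphaS => 0 | Gamma => -2 | GammaS => 2 end.
Definition U_deg (x : U_gen) : int :=
  match x with Ee => -2 | Ff => 2 | Kk | KkS | KkV | KkSV => 0 end.

Definition SU_homog : int -> SU2 -> Prop := homog SU_deg.
Definition U_homog : int -> U2 -> Prop := homog U_deg.

(* Xi (u ⊗ v) = e^{2iφ δ(u)δ(v)} v ⊗ u on homogeneous elements *)
Definition degree_braiding (U V : lmodType C) (homU : int -> U -> Prop)
    (homV : int -> V -> Prop) (Xi : {linear U ⊗ V -> V ⊗ U}) : Prop :=
  forall (m n : int) (u : U) (v : V), homU m u -> homV n v ->
    Xi (u ⊗: v) = cexpi (2 * phi * (m * n)%:~R) *: (v ⊗: u).

Section SUStructure.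
Local Notation a := (gSU Alpha).
Local Notation a' := (gSU AlphaS).
Local Notation c := (gSU Gamma).
Local Notation c' := (gSU GammaS).

Record is_SU2 (HA : braidedHopf SU2) : Prop := IsSU2 {
  SU_psi : degree_braiding SU_homog SU_homog (bpsi HA);
  SU_delta_a  : bdelta HA a = a ⊗: a - (Q * E (-4)) *: (c' ⊗: c);
  SU_delta_c  : bdelta HA c = c ⊗: a + a' ⊗: c;
  SU_delta_a' : bdelta HA a' = a' ⊗: a' - (Q * E (-4)) *: (c ⊗: c');
  SU_delta_c' : bdelta HA c' = c' ⊗: a' + a ⊗: c';
  SU_eps_a  : beps HA a = 1;
  SU_eps_a' : beps HA a' = 1;
  SU_eps_c  : beps HA c = 0;
  SU_eps_c' : beps HA c' = 0;
  SU_antip_a  : bantip HA a = a';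
  SU_antip_a' : bantip HA a' = a;
  SU_antip_c  : bantip HA c = - (Q * E 4) *: c;
  SU_antip_c' : bantip HA c' = - (Q^-1 * E 4) *: c'
}.
End SUStructure.

Section UStructure.
Local Notation e := (gU Ee).
Local Notation f := (gU Ff).
Local Notation k := (gU Kk).
Local Notation k' := (gU KkS).
Local Notation kV := (gU KkV).
Local Notation k'V := (gU KkSV).

Record is_U2 (HH : braidedHopf U2) : Prop := IsU2 {
  U_psi : degree_braiding U_homog U_homog (bpsi HH);
  U_delta_k  : bdelta HH k = k ⊗: k;
  U_delta_k' : bdelta HH k' = k' ⊗: k';
  U_delta_e  : bdelta HH e = e ⊗: k + kV ⊗: e;
  U_delta_f  : bdelta HH f = f ⊗: k' + k'V ⊗: f;
  U_eps_e  : beps HH e = 0;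
  U_eps_f  : beps HH f = 0;
  U_eps_k  : beps HH k = 1;
  U_eps_k' : beps HH k' = 1;
  U_antip_e  : bantip HH e = - (Q^-1 * E 4) *: e;
  U_antip_f  : bantip HH f = - (Q * E 4) *: f;
  U_antip_k  : bantip HH k = kV;
  U_antip_k' : bantip HH k' = k'V
}.
End UStructure.

Local Notation rQ := (((Num.sqrt q)%:C)%C : C).

Definition pair_gen (h : U_gen) (x : SU_gen) : C :=
  match h, x with
  | Ee, GammaS => - (Q^-1 * E (-4))
  | Ff, Gamma => 1
  | Kk, Alpha => rQ^-1 * E 2
  | Kk, AlphaS => rQ * E (-2)
  | KkS, Alpha => rQ^-1 * E (-2)
  | KkS, AlphaS => rQ * E 2
  | KkV, Alpha => rQ * E (-2)
  | KkV, AlphaS => rQ^-1 * E 2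
  | KkSV, Alpha => rQ * E 2
  | KkSV, AlphaS => rQ^-1 * E (-2)
  | _, _ => 0
  end.

End QuantumAlgebras.

(* Main.v *)
Require Import Defs.
From HB Require Import structures.
From mathcomp Require Import all_boot all_order all_algebra.
From mathcomp Require Import reals topology normedtype trigo complex.
From mathcomp Require Import ring.
Import Order.TTheory GRing.Theory Num.Theory.
Local Open Scope ring_scope.

(* All braidings multiply by c(mn) on degrees m, n, where c(n) = e^{2iφn} is
   multiplicative, both coproducts preserve the degree, and the pairing vanishes
   on h ⊗ a unless δ(h) + δ(a) = 0 (this holds on generators and propagates
   through the two pairing axioms). On homogeneous elements every axiom becomes
   an identity between sums over Sweedler components with scalar coefficients
   c(N), and the exponents N agree once the degrees forced by the nonvanishing
   of the pairing are substituted. For instance, with products of names standing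
   for products of degrees,
     h ▷ (x y) = Σ c(h (x1 + y1) + x2 y1 + h2 x2) <h1, x2> <h2, y2> x1 y1,
     c(h2 x) (h1 ▷ x) (h2 ▷ y)
               = Σ c(h2 x + h1 x1 + h2 y1) <h1, x2> <h2, y2> x1 y1,
   and h = h1 + h2, x = x1 + x2, x2 = - h1 make the exponents equal. *)

Set Implicit Arguments.
Unset Strict Implicit.
Unset Printing Implicit Defensive.

(** * Tensors of homogeneous elements *)

Section TensorEvaluation.
Variable K : fieldType.

(** With [tens u] a bundled linear map, sums and scalars come out of the right factor, and an
    argument can be fixed by composing with [tens u]. *)
HB.instance Definition _ (U V : lmodType K) (u : U) :=
  GRing.isLinear.Build K V (U ⊗ V) _ (tens u)
    (fun a v w => etrans (tensDr u (a *: v) w)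
                    (congr1 (+%R^~ (u ⊗: w)) (tensZr a u v))).

Lemma tens0l (U V : lmodType K) (v : V) : (0 : U) ⊗: v = 0.
Proof. by rewrite -(scale0r 0) tensZl scale0r. Qed.

Lemma tens_suml (U V : lmodType K) (I : finType) (u : I -> U) (v : V) :
  (\sum_i u i) ⊗: v = \sum_i u i ⊗: v.
Proof.
by apply: (big_morph (fun x => x ⊗: v)) => [x y|]; rewrite ?tensDl ?tens0l.
Qed.

(** On homogeneous vectors a braiding yields one scaled pure tensor. This shape survives extension
    to further legs, so long composites can be evaluated step by step. *)
Lemma tfst_pure (U V W X Y : lmodType K) (f : {linear U ⊗ V -> X ⊗ Y})
    u v (w : W) a x y :
  f (u ⊗: v) = a *: (x ⊗: y) -> tfst f (u ⊗: (v ⊗: w)) = a *: (x ⊗: (y ⊗: w)).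
Proof.
by move=> fE; rewrite /tfst /= tassocVE tmapE fE tensZl linearZ /= tassocE.
Qed.

Lemma tsnd_pure (U V W X Y : lmodType K) (f : {linear V ⊗ W -> X ⊗ Y})
    (u : U) v w a x y :
  f (v ⊗: w) = a *: (x ⊗: y) -> tsnd f ((u ⊗: v) ⊗: w) = a *: ((u ⊗: x) ⊗: y).
Proof.
by move=> fE; rewrite /tsnd /= tassocE tmapE fE tensZr linearZ /= tassocVE.
Qed.

Lemma tmid_pure (U V W X Y Z : lmodType K) (f : {linear V ⊗ W -> X ⊗ Y})
    (u : U) v w (z : Z) a x y :
  f (v ⊗: w) = a *: (x ⊗: y) ->
  tmid f ((u ⊗: v) ⊗: (w ⊗: z)) = a *: ((u ⊗: x) ⊗: (y ⊗: z)).
Proof.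
move=> fE; rewrite /tmid /= tassocE tmapE (tfst_pure z fE) tensZr linearZ /=.
by rewrite tassocVE.
Qed.

End TensorEvaluation.

(** * Graded algebras and homogeneous tensors *)

Section Grading.
Variable K : fieldType.

(** Closure under sums is enough to express spanning, because [hom_scale] absorbs scalars into the
    homogeneous summands. *)
Inductive hspan (V : lmodType K) (hom : int -> V -> Prop) : V -> Prop :=
| hspan_hom n x : hom n x -> hspan hom x
| hspan_zero : hspan hom 0
| hspan_add x y : hspan hom x -> hspan hom y -> hspan hom (x + y).

Record grading (B : algType K) (hom : int -> B -> Prop) : Prop := Grading {
  hom_span : forall x, hspan hom x;
  hom_one : hom 0 1;
  hom_mul : forall m n x y, hom m x -> hom n y -> hom (m + n) (x * y);
  hom_scale : forall n a x, hom n x -> hom n (a *: x)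
}.

Lemma hspan_eq (V W : lmodType K) (hom : int -> V -> Prop)
    (f g : {linear V -> W}) :
  (forall n x, hom n x -> f x = g x) -> forall x, hspan hom x -> f x = g x.
Proof.
move=> fg x; elim=> [n y /fg //||y z _ IHy _ IHz]; first by rewrite !linear0.
by rewrite !linearD IHy IHz.
Qed.

Section TensorExt.
Variables (U V W X : lmodType K).
Variables (hU : int -> U -> Prop) (hV : int -> V -> Prop) (hW : int -> W -> Prop).
Hypotheses (sU : forall x, hspan hU x) (sV : forall x, hspan hV x).
Hypothesis (sW : forall x, hspan hW x).

Lemma tens_ext (f g : {linear U ⊗ V -> X}) :
  (forall m n u v, hU m u -> hV n v -> f (u ⊗: v) = g (u ⊗: v)) -> f =1 g.
Proof.
move=> fg; apply: linear_eq_tens => u v.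
elim: (sV v) => [n {}v hv||v1 v2 _ IH1 _ IH2]; last first.
- by rewrite !linearD /= IH1 IH2.
- by rewrite !linear0.
elim: (sU u) => [m {}u hu||u1 u2 _ IH1 _ IH2]; first exact: fg hu hv.
- by rewrite tens0l !linear0.
- by rewrite tensDl !linearD /= IH1 IH2.
Qed.

Lemma tens_extr (f g : {linear U ⊗ (V ⊗ W) -> X}) :
  (forall m n k u v w, hU m u -> hV n v -> hW k w ->
     f (u ⊗: (v ⊗: w)) = g (u ⊗: (v ⊗: w))) -> f =1 g.
Proof.
move=> fg; apply: linear_eq_tens => u t.
elim: (sU u) => [m {}u hu||u1 u2 _ IH1 _ IH2].
- elim/tensor_ind: t => [v w||x y IHx IHy|a x IHx].
  + elim: (sV v) => [n {}v hv||v1 v2 _ IH1 _ IH2].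
    * elim: (sW w) => [k {}w hw||w1 w2 _ IH1 _ IH2]; first exact: fg hu hv hw.
        by rewrite !linear0.
      by rewrite !linearD /= IH1 IH2.
    * by rewrite tens0l !linear0.
    * by rewrite tensDl !linearD /= IH1 IH2.
  + by rewrite !linear0.
  + by rewrite !linearD /= IHx IHy.
  + by rewrite !linearZ /= IHx.
- by rewrite tens0l !linear0.
- by rewrite tensDl !linearD /= IH1 IH2.
Qed.

End TensorExt.

(** Reduces to [tens_extr] by precomposing both maps with the associator. *)
Lemma tens_extl (U V W X : lmodType K) (hU : int -> U -> Prop)
    (hV : int -> V -> Prop) (hW : int -> W -> Prop)
    (f g : {linear (U ⊗ V) ⊗ W -> X}) :
  (forall x, hspan hU x) -> (forall x, hspan hV x) -> (forall x, hspan hW x) ->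
  (forall m n k u v w, hU m u -> hV n v -> hW k w ->
     f ((u ⊗: v) ⊗: w) = g ((u ⊗: v) ⊗: w)) -> f =1 g.
Proof.
move=> sU sV sW fg; apply: linear_eq_tens => t w.
have fgr : f \o @tassocV K U V W =1 g \o @tassocV K U V W.
  apply: (tens_extr sU sV sW) => m n k u v {}w hu hv hw /=.
  by rewrite tassocVE; apply: fg hu hv hw.
by elim/tensor_ind: t => [u v||x y IHx IHy|a x IHx];
  rewrite ?tens0l ?tensDl ?tensZl ?linear0 ?linearD ?linearZ /= ?IHx ?IHy //;
  have := fgr (u ⊗: (v ⊗: w)); rewrite /= tassocVE.
Qed.

(** The total degree on a tensor product. The predicates [hU] and [hV] are arbitrary, so that they
    can be homogeneity or the smaller predicate [SU_genline]. *)
Inductive thom (U V : lmodType K) (hU : int -> U -> Prop)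
    (hV : int -> V -> Prop) (n : int) : U ⊗ V -> Prop :=
| thom_pure i j u v : hU i u -> hV j v -> i + j = n -> thom hU hV n (u ⊗: v)
| thom_zero : thom hU hV n 0
| thom_add x y : thom hU hV n x -> thom hU hV n y -> thom hU hV n (x + y)
| thom_scale a x : thom hU hV n x -> thom hU hV n (a *: x).

Lemma thom_sub (U V : lmodType K) (hU hU' : int -> U -> Prop)
    (hV hV' : int -> V -> Prop) n t :
  (forall i u, hU i u -> hU' i u) -> (forall j v, hV j v -> hV' j v) ->
  thom hU hV n t -> thom hU' hV' n t.
Proof.
move=> sU sV; elim=> [i j u v /sU hu /sV hv <-||x y _ IHx _ IHy|a x _ IHx].
- exact: thom_pure hu hv _.
- exact: thom_zero.
- exact: thom_add.
- exact: thom_scale.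
Qed.

(** Provides Sweedler notation with homogeneous components. Scalars are absorbed into the first
    factor, which is why [hU] must be stable under scaling. *)
Lemma thom_sum (U V : lmodType K) (hU : int -> U -> Prop)
    (hV : int -> V -> Prop) n t :
  (forall i a u, hU i u -> hU i (a *: u)) -> thom hU hV n t ->
  exists (I : finType) (i j : I -> int) (u : I -> U) (v : I -> V),
    [/\ forall k, hU (i k) (u k), forall k, hV (j k) (v k),
        forall k, i k + j k = n & t = \sum_k u k ⊗: v k].
Proof.
move=> hZ; elim=> [i j u v hu hv ijn|||].
- exists unit, (fun=> i), (fun=> j), (fun=> u), (fun=> v); split=> //.
  by rewrite big_const card_unit /= addr0.
- exists void, (fun=> 0), (fun=> 0), (fun=> 0), (fun=> 0); split=> [[]|[]|[]|].
  by rewrite big_pred0 // => -[].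
- move=> x y _ [I [i [j [u [v [hu hv ij ->]]]]]].
  move=> _ [J [i' [j' [u' [v' [hu' hv' ij' ->]]]]]].
  exists (I + J)%type, (sum_rect _ i i'), (sum_rect _ j j').
  exists (sum_rect _ u u'), (sum_rect _ v v').
  by split=> [[]|[]|[]|] //; rewrite big_sumType.
- move=> a x _ [I [i [j [u [v [hu hv ij ->]]]]]].
  exists I, i, j, (fun k => a *: u k), v; split=> // [k|]; first exact: hZ.
  by rewrite scaler_sumr; apply: eq_bigr => k _; rewrite tensZl.
Qed.

End Grading.

(* Keeps [/=] from unfolding the legs, on which the lemmas above rewrite. *)
Local Opaque tfst tsnd tmid.

(** * Braidings by a bicharacter *)

Section BicharacterBraiding.
Variables (K : fieldType) (c : int -> K).
Hypotheses (c0 : c 0 = 1) (cD : forall m n, c (m + n) = c m * c n).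

Definition bichar_braiding (U V : lmodType K) (hU : int -> U -> Prop)
    (hV : int -> V -> Prop) (X : {linear U ⊗ V -> V ⊗ U}) : Prop :=
  forall (m n : int) u v, hU m u -> hV n v ->
    X (u ⊗: v) = c (m * n) *: (v ⊗: u).

Section BraidingLaws.
Variables (B : algType K) (hB : int -> B -> Prop) (gB : grading hB).
Variables (V : lmodType K) (hV : int -> V -> Prop).
Hypothesis sV : forall x, hspan hV x.

Let sB : forall x, hspan hB x := hom_span gB.

(** Since [c] turns sums into products, [c (m * n)] is multiplicative in each degree separately:
    crossing a product costs the same as crossing its factors in turn. *)
Lemma bichar_mull (X : {linear B ⊗ V -> V ⊗ B}) :
  bichar_braiding hB hV X -> braid_mull X.
Proof.
move=> hX; apply: (tens_extl sB sB sV) => m n k u v w hu hv hw /=.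
rewrite tmapE /= tmulE (hX _ _ _ _ (hom_mul gB hu hv) hw).
rewrite (tsnd_pure u (hX _ _ _ _ hv hw)) !linearZ /= tmapE /=.
rewrite (hX _ _ _ _ hu hw) tensZl !linearZ /= tassocE tmapE /= tmulE scalerA -cD.
by congr (c _ *: _); ring.
Qed.

Lemma bichar_mulr (X : {linear V ⊗ B -> B ⊗ V}) :
  bichar_braiding hV hB X -> braid_mulr X.
Proof.
move=> hX; apply: (tens_extr sV sB sB) => m n k u v w hu hv hw /=.
rewrite tmapE /= tmulE (hX _ _ _ _ hu (hom_mul gB hv hw)).
rewrite (tfst_pure w (hX _ _ _ _ hu hv)) !linearZ /= tmapE /=.
rewrite (hX _ _ _ _ hu hw) tensZr !linearZ /= tassocVE tmapE /= tmulE scalerA -cD.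
by congr (c _ *: _); ring.
Qed.

Variable Delta : {linear B -> B ⊗ B}.
Hypothesis hD : forall n x, hB n x -> thom hB hB n (Delta x).

(** The degrees of the two legs of [Delta u] add up to that of [u], so their crossing factors
    multiply to the crossing factor of [u]. *)
Lemma bichar_comull (X : {linear B ⊗ V -> V ⊗ B}) :
  bichar_braiding hB hV X -> braid_comull Delta X.
Proof.
move=> hX; apply: (tens_ext sB sV) => m n u v hu hv /=.
rewrite (hX _ _ _ _ hu hv) linearZ /= !tmapE.
have [I [i [j [u1 [u2 [h1 h2 ij ->]]]]]] := thom_sum (hom_scale gB) (hD hu).
rewrite linear_sum tens_suml !linear_sum; apply: eq_bigr => k _.
rewrite (tsnd_pure _ (hX _ _ _ _ (h2 k) hv)) !linearZ /= tmapE /=.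
rewrite (hX _ _ _ _ (h1 k) hv) tensZl !linearZ /= tassocE scalerA -cD -(ij k).
by congr (c _ *: _); ring.
Qed.

Lemma bichar_comulr (X : {linear V ⊗ B -> B ⊗ V}) :
  bichar_braiding hV hB X -> braid_comulr Delta X.
Proof.
move=> hX; apply: (tens_ext sV sB) => m n u v hu hv /=.
rewrite (hX _ _ _ _ hu hv) linearZ /= !tmapE.
have [I [i [j [u1 [u2 [h1 h2 ij ->]]]]]] := thom_sum (hom_scale gB) (hD hv).
rewrite tens_suml !linear_sum; apply: eq_bigr => k _ /=.
rewrite (tfst_pure _ (hX _ _ _ _ hu (h1 k))) !linearZ /= tmapE /=.
rewrite (hX _ _ _ _ hu (h2 k)) tensZr !linearZ /= tassocVE scalerA -cD -(ij k).
by congr (c _ *: _); ring.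
Qed.

End BraidingLaws.

(** * Coproducts of products *)

Section GradedBraidedHopf.
Variables (B : algType K) (hB : int -> B -> Prop) (gB : grading hB).
Variable HB : braidedHopf B.
Hypothesis hpsi : bichar_braiding hB hB (bpsi HB).

(** Multiplicativity of the coproduct in Sweedler form. Only the inner legs [b] and [a'] cross, so
    the scalar depends on their degrees alone. *)
Lemma bdelta_mul_sum x y (I J : finType) (i2 : I -> int) (j1 : J -> int)
    (a b : I -> B) (a' b' : J -> B) :
  (forall k, hB (i2 k) (b k)) -> (forall l, hB (j1 l) (a' l)) ->
  bdelta HB x = \sum_k a k ⊗: b k -> bdelta HB y = \sum_l a' l ⊗: b' l ->
  bdelta HB (x * y) =
    \sum_k \sum_l c (i2 k * j1 l) *: ((a k * a' l) ⊗: (b k * b' l)).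
Proof.
move=> hb ha' Dx Dy; have := bdelta_mul HB (x ⊗: y).
rewrite /= tmulE tmapE Dx Dy tens_suml !linear_sum => ->.
apply: eq_bigr => k _; rewrite !linear_sum; apply: eq_bigr => l _ /=.
rewrite (tmid_pure _ _ (hpsi (hb k) (ha' l))) linearZ /= tmapE /=.
by rewrite !tmulE.
Qed.

Lemma thom_bdelta_mul m n x y :
  thom hB hB m (bdelta HB x) -> thom hB hB n (bdelta HB y) ->
  thom hB hB (m + n) (bdelta HB (x * y)).
Proof.
move=> /(thom_sum (hom_scale gB)) [I [i1 [i2 [a [b [ha hb i12 Dx]]]]]].
move=> /(thom_sum (hom_scale gB)) [J [j1 [j2 [a' [b' [ha' hb' j12 Dy]]]]]].
rewrite (bdelta_mul_sum hb ha' Dx Dy).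
elim/big_ind: _ => [||k _]; [exact: thom_zero|exact: thom_add|].
elim/big_ind: _ => [||l _]; [exact: thom_zero|exact: thom_add|].
apply/thom_scale/(thom_pure (hom_mul gB (ha k) (ha' l))
                            (hom_mul gB (hb k) (hb' l))).
by rewrite -(i12 k) -(j12 l); ring.
Qed.

End GradedBraidedHopf.

End BicharacterBraiding.

(** * The two actions *)

Section GradedBraidedAction.
Variables (K : fieldType) (c : int -> K).
Hypotheses (c0 : c 0 = 1) (cD : forall m n, c (m + n) = c m * c n).
Variables (H A : algType K) (hH : int -> H -> Prop) (hA : int -> A -> Prop).
Hypotheses (gH : grading hH) (gA : grading hA).
Variables (HH : braidedHopf H) (HA : braidedHopf A).
Hypotheses (hpsiH : bichar_braiding c hH hH (bpsi HH))
           (hpsiA : bichar_braiding c hA hA (bpsi HA)).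
Hypotheses (hDH : forall n h, hH n h -> thom hH hH n (bdelta HH h))
           (hDA : forall n x, hA n x -> thom hA hA n (bdelta HA x)).
Variables (Xi : {linear H ⊗ A -> A ⊗ H}) (p : {linear H ⊗ A -> K^o}).
Hypotheses (hXi : bichar_braiding c hH hA Xi) (hp : braided_pairing HH HA Xi p).
Hypothesis p0 : forall m n h x, hH m h -> hA n x -> m + n != 0 -> p (h ⊗: x) = 0.

Let sH : forall h, hspan hH h := hom_span gH.
Let sA : forall x, hspan hA x := hom_span gA.
Let swA n x (hx : hA n x) := thom_sum (hom_scale gA) (hDA hx).
Let swH n h (hh : hH n h) := thom_sum (hom_scale gH) (hDH hh).

Lemma pair_mulr_sum n h x y (I : finType) (j : I -> int) (h1 h2 : I -> H) :
  hA n x -> (forall k, hH (j k) (h2 k)) -> bdelta HH h = \sum_k h1 k ⊗: h2 k ->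
  p (h ⊗: (x * y)) =
    \sum_k c (j k * n) * (p (h1 k ⊗: x) * p (h2 k ⊗: y)).
Proof.
move=> hx hh2 Dh; have := pair_mulr hp (h ⊗: (x ⊗: y)).
rewrite /= !tmapE /= tmulE Dh => ->.
rewrite tens_suml !linear_sum; apply: eq_bigr => k _ /=.
by rewrite (tmid_pure _ _ (hXi (hh2 k) hx)) !linearZ /= tmapE tunitlE.
Qed.

Lemma pair_mull_sum n h g x (I : finType) (i : I -> int) (a b : I -> A) :
  hH n g -> (forall k, hA (i k) (a k)) -> bdelta HA x = \sum_k a k ⊗: b k ->
  p ((h * g) ⊗: x) =
    \sum_k c (n * i k) * (p (h ⊗: a k) * p (g ⊗: b k)).
Proof.
move=> hg ha Dx; have := pair_mull hp ((h ⊗: g) ⊗: x).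
rewrite /= !tmapE /= tmulE Dx => ->.
rewrite !linear_sum; apply: eq_bigr => k _ /=.
by rewrite (tmid_pure _ _ (hXi hg (ha k))) !linearZ /= tmapE tunitlE.
Qed.

(** * The left action *)

Section Left.
Local Notation act := (left_action HA Xi p).

(** The left action with the coproduct stripped off: any expression for the coproduct of [x] can be
    inserted, from multiplicativity or from coassociativity. *)
Definition lcoact : {linear H ⊗ (A ⊗ A) -> A} :=
  @tunitr K A \o tmap idfun p \o tfst Xi.

Lemma lactE h x : act (h ⊗: x) = lcoact (h ⊗: bdelta HA x).
Proof. by rewrite /left_action /lcoact /= tmapE. Qed.

Lemma lcoact_pure m n h a b : hH m h -> hA n a ->
  lcoact (h ⊗: (a ⊗: b)) = (c (m * n) * p (h ⊗: b)) *: a.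
Proof.
move=> hh ha; rewrite /lcoact /= (tfst_pure b (hXi hh ha)) !linearZ /= tmapE.
by rewrite tunitrE scalerA.
Qed.

Local Opaque left_action lcoact.

Lemma lact_sum m h x (I : finType) (i : I -> int) (a b : I -> A) :
  hH m h -> (forall k, hA (i k) (a k)) -> bdelta HA x = \sum_k a k ⊗: b k ->
  act (h ⊗: x) = \sum_k (c (m * i k) * p (h ⊗: b k)) *: a k.
Proof.
move=> hh ha Dx; rewrite lactE Dx !linear_sum; apply: eq_bigr => k _ /=.
exact: lcoact_pure.
Qed.

Lemma left_action_mulA : act \o tmap idfun (@tmul K A) =1
  @tmul K A \o tmap act act \o tmid Xi \o tmap (bdelta HH) idfun.
Proof.
apply: (tens_extr sH sA sA) => m n k h x y hh hx hy /=; rewrite !tmapE /= tmulE.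
have [I [i1 [i2 [h1 [h2 [hh1 hh2 i12 Dh]]]]]] := swH hh.
have [J [j1 [j2 [a [b [ha hb j12 Dx]]]]]] := swA hx.
have [L [l1 [l2 [a' [b' [ha' hb' l12 Dy]]]]]] := swA hy.
rewrite lactE (bdelta_mul_sum hpsiA hb ha' Dx Dy) Dh tens_suml !linear_sum /=.
(* The expanded right-hand side: the three terms of the exponent come from [h2] crossing [x], from
   [h1] acting on [x], and from [h2] acting on [y]. *)
transitivity (\sum_r \sum_s \sum_t
  (c (i2 r * n + i1 r * j1 s + i2 r * l1 t) *
     (p (h1 r ⊗: b s) * p (h2 r ⊗: b' t))) *: (a s * a' t)).
  rewrite [RHS]exchange_big /=; apply: eq_bigr => s _.
  rewrite [RHS]exchange_big /= !linear_sum; apply: eq_bigr => t _ /=.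
  rewrite !linearZ /= (lcoact_pure _ hh (hom_mul gA (ha s) (ha' t))) scalerA.
  rewrite (pair_mulr_sum _ (hb s) hh2 Dh) !mulr_sumr scaler_suml.
  apply: eq_bigr => r _; rewrite !mulrA -!cD -!mulrA.
  (* Either the first pairing vanishes and both terms are zero, or [j2 s] is the opposite of [i1 r]
     and the exponents agree. *)
  have [e|ne] := eqVneq (i1 r + j2 s) 0; last first.
    by rewrite (p0 (hh1 r) (hb s) ne) !(mul0r, mulr0).
  congr ((c _ * _) *: _); rewrite -(i12 r) -(j12 s).
  by rewrite -(addr0_eq e); ring.
apply: eq_bigr => r _.
rewrite (tmid_pure _ _ (hXi (hh2 r) hx)) !linearZ /= tmapE tmulE /=.
rewrite (lact_sum (hh1 r) ha Dx) (lact_sum (hh2 r) ha' Dy).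
rewrite mulr_suml scaler_sumr; apply: eq_bigr => s _.
rewrite mulr_sumr scaler_sumr; apply: eq_bigr => t _.
rewrite -scalerAl -scalerAr !scalerA !cD; congr (_ *: _); ring.
Qed.

Lemma left_action_mulH : act \o tmap (@tmul K H) idfun =1
  act \o tmap idfun act \o @tassoc K H H A.
Proof.
apply: (tens_extl sH sH sA) => m n k h g x hh hg hx /=.
rewrite tassocE !tmapE /= tmulE.
(* [Theta] carries the grading factors that the two bracketings of the threefold
   coproduct share, so that coassociativity applies to it. *)
have [Theta ThetaE] : exists Theta : {linear A ⊗ (A ⊗ A) -> A},
    forall i u v w, hA i u -> Theta (u ⊗: (v ⊗: w)) =
      (c ((m + n) * i) * (p (h ⊗: v) * p (g ⊗: w))) *: u.
  (* After the last two legs are flipped, [g] consumes [w] and then [h] consumes [v]; [u] survives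
     both. *)
  exists (lcoact \o @tens K H (A ⊗ A) h \o
    tmap (lcoact \o @tens K H (A ⊗ A) g) idfun \o @tassocV K A A A \o
    tmap idfun (@tflip K A A)) => i u v w hu /=.
  rewrite tmapE /= tflipE tassocVE tmapE /=.
  rewrite (lcoact_pure _ hg hu) tensZl !linearZ /= (lcoact_pure _ hh hu) scalerA.
  by rewrite mulrDl cD; congr (_ *: _); ring.
have [I [i1 [i2 [a [b [ha hb i12 Dx]]]]]] := swA hx.
(* In the pairing of [h * g], the factor [g] crosses the leg paired with [h]. That leg must have
   degree [- m], so the crossing factor is the same for all summands. *)
transitivity (c (- (n * m)) *: Theta (tmap idfun (bdelta HA) (bdelta HA x))).
  rewrite (lact_sum (hom_mul gH hh hg) ha Dx) Dx !linear_sum.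
  apply: eq_bigr => s _ /=; rewrite tmapE /=.
  have [J [j1 [j2 [u [v [hu hv j12 Db]]]]]] := swA (hb s).
  rewrite Db !linear_sum (pair_mull_sum _ hg hu Db) mulr_sumr scaler_suml.
  apply: eq_bigr => t _ /=; rewrite (ThetaE _ _ _ _ (ha s)) scalerA !mulrA -!cD.
  have [e|ne] := eqVneq (m + j1 t) 0; last first.
    by rewrite (p0 hh (hu t) ne) !(mul0r, mulr0).
  by congr ((c _ * _ * _) *: _); rewrite -(addr0_eq e); ring.
have := bdelta_coassoc HA x; rewrite /= => <-.
rewrite Dx !linear_sum (lactE g) Dx !linear_sum; apply: eq_bigr => s _ /=.
rewrite tmapE /= (lcoact_pure _ hg (ha s)) !linearZ /= lactE.
have [J [j1 [j2 [u [v [hu hv j12 Da]]]]]] := swA (ha s).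
rewrite Da tens_suml !linear_sum; apply: eq_bigr => t _ /=.
rewrite tassocE (ThetaE _ _ _ _ (hu t)) (lcoact_pure _ hh (hu t)) !scalerA.
have [e|ne] := eqVneq (m + j2 t) 0; last first.
  by rewrite (p0 hh (hv t) ne) !(mul0r, mulr0).
(* The same factor reappears when acting in two steps: [g] crosses the whole first leg, including
   the part of degree [- m] later paired with [h]. *)
have -> : c (n * i1 s) = c (- (n * m)) * c (n * j1 t).
  by rewrite -cD -(j12 t) -(addr0_eq e); congr c; ring.
by rewrite mulrDl cD; congr (_ *: _); ring.
Qed.

Lemma left_action_module_algebra : left_braided_module_algebra HH Xi act.
Proof.
split.
- exact (bichar_mull cD gH sA hXi).
- exact (bichar_mulr cD gA sH hXi).
- exact (bichar_comull cD gH sA hDH hXi).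
- exact: left_action_mulA.
- exact: left_action_mulH.
(* Pairing with [g] forces degree [- n] on the second leg of [x], so acting by [g] raises the degree
   by [n]. Crossing the result thus costs as much as crossing [g] and then [x]. *)
- apply: (tens_extr sH sH sA) => m n k h g x hh hg hx /=.
  have [I [i1 [i2 [a [b [ha hb i12 Dx]]]]]] := swA hx.
  rewrite tmapE (tfst_pure _ (hpsiH hh hg)) !linearZ /= tmapE /= (hXi hh hx).
  rewrite !linearZ /= tassocVE tmapE /= !(lact_sum hg ha Dx).
  rewrite tens_suml !linear_sum; apply: eq_bigr => s _ /=.
  rewrite tensZr !tensZl linearZ /= (hXi hh (ha s)) !scalerA.
  have [e|ne] := eqVneq (n + i2 s) 0; last first.
    by rewrite (p0 hg (hb s) ne) !(mul0r, mulr0).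
  rewrite -(i12 s) -(addr0_eq e).
  have -> : c (m * i1 s) = c (m * n) * c (m * (i1 s - n)).
    by rewrite -cD; congr c; ring.
  by congr (_ *: _); ring.
- move=> x.
  (* Phrased with linear maps so that [hspan_eq] reduces to homogeneous [x]. There the unit has
     degree 0 and pairs as the counit, leaving the counit axiom. *)
  have : (act \o @tens K H A 1) x = (idfun : {linear A -> A}) x; last by [].
  apply: hspan_eq (sA x) => n {}x hx /=.
  have [I [i1 [i2 [a [b [ha hb i12 Dx]]]]]] := swA hx.
  have := bdelta_epsr HA x; rewrite /= Dx !linear_sum => xE.
  rewrite (lact_sum (hom_one gH) ha Dx) -[RHS]xE; apply: eq_bigr => s _.
  by rewrite mul0r c0 mul1r (pair_onel hp) /= tmapE tunitrE.
- move=> h; elim: (sH h) => [m {}h hh||h1 h2 _ E1 _ E2].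
  + rewrite lactE bdelta_one (lcoact_pure _ hh (hom_one gA)) mulr0 c0 mul1r.
    by rewrite (pair_oner hp).
  + by rewrite tens0l !linear0 scale0r.
  + by rewrite tensDl !linearD /= E1 E2 scalerDl.
Qed.
End Left.

(** * The right action *)

Section Right.
Variable Xi' : {linear A ⊗ H -> H ⊗ A}.
Hypothesis hXi' : bichar_braiding c hA hH Xi'.
Local Notation act := (right_action HA Xi' (p \o @tflip K A H)).

Definition rcoact : {linear (A ⊗ A) ⊗ H -> A} :=
  @tunitl K A \o tmap (p \o @tflip K A H) idfun \o tsnd Xi'.

Lemma ractE x h : act (x ⊗: h) = rcoact (bdelta HA x ⊗: h).
Proof. by rewrite /right_action /rcoact /= tmapE. Qed.

Lemma rcoact_pure m n h a b : hH m h -> hA n b ->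
  rcoact ((a ⊗: b) ⊗: h) = (c (n * m) * p (h ⊗: a)) *: b.
Proof.
move=> hh hb; rewrite /rcoact /= (tsnd_pure a (hXi' hb hh)) !linearZ /= tmapE.
by rewrite /= tflipE tunitlE scalerA.
Qed.

Local Opaque right_action rcoact.

Lemma ract_sum m h x (I : finType) (j : I -> int) (a b : I -> A) :
  hH m h -> (forall k, hA (j k) (b k)) -> bdelta HA x = \sum_k a k ⊗: b k ->
  act (x ⊗: h) = \sum_k (c (j k * m) * p (h ⊗: a k)) *: b k.
Proof.
move=> hh hb Dx; rewrite ractE Dx tens_suml !linear_sum.
by apply: eq_bigr => k _ /=; exact: rcoact_pure.
Qed.

Lemma right_action_mulA : act \o tmap (@tmul K A) idfun =1
  @tmul K A \o tmap act act \o tmid Xi' \o tmap idfun (bdelta HH).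
Proof.
apply: (tens_extl sA sA sH) => n k m x y h hx hy hh /=; rewrite !tmapE /= tmulE.
have [I [i1 [i2 [h1 [h2 [hh1 hh2 i12 Dh]]]]]] := swH hh.
have [J [j1 [j2 [a [b [ha hb j12 Dx]]]]]] := swA hx.
have [L [l1 [l2 [a' [b' [ha' hb' l12 Dy]]]]]] := swA hy.
rewrite ractE (bdelta_mul_sum hpsiA hb ha' Dx Dy) Dh tens_suml !linear_sum /=.
transitivity (\sum_r \sum_s \sum_t
  (c (k * i1 r + j2 s * i1 r + l2 t * i2 r) *
     (p (h1 r ⊗: a s) * p (h2 r ⊗: a' t))) *: (b s * b' t)).
  rewrite [RHS]exchange_big /=; apply: eq_bigr => s _.
  rewrite [RHS]exchange_big /= tens_suml !linear_sum; apply: eq_bigr => t _ /=.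
  rewrite tensZl !linearZ /= (rcoact_pure _ hh (hom_mul gA (hb s) (hb' t))).
  rewrite scalerA (pair_mulr_sum _ (ha s) hh2 Dh) !mulr_sumr scaler_suml.
  apply: eq_bigr => r _; rewrite !mulrA -!cD -!mulrA.
  have [e|ne] := eqVneq (i1 r + j1 s) 0; last first.
    by rewrite (p0 (hh1 r) (ha s) ne) !(mul0r, mulr0).
  (* Here the exponents agree only after the degrees forced by both pairings are substituted; on the
     left the first pairing suffices. *)
  have [e'|ne] := eqVneq (i2 r + l1 t) 0; last first.
    by rewrite (p0 (hh2 r) (ha' t) ne) !(mul0r, mulr0).
  congr ((c _ * _) *: _); rewrite -(i12 r) -(l12 t).
  by rewrite -(addr0_eq e) -(addr0_eq e'); ring.
apply: eq_bigr => r _.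
rewrite (tmid_pure _ _ (hXi' hy (hh1 r))) !linearZ /= tmapE tmulE /=.
rewrite (ract_sum (hh1 r) hb Dx) (ract_sum (hh2 r) hb' Dy).
rewrite mulr_suml scaler_sumr; apply: eq_bigr => s _.
rewrite mulr_sumr scaler_sumr; apply: eq_bigr => t _.
rewrite -scalerAl -scalerAr !scalerA !cD; congr (_ *: _); ring.
Qed.

Lemma right_action_mulH : act \o tmap idfun (@tmul K H) =1
  act \o tmap act idfun \o @tassocV K A H H.
Proof.
apply: (tens_extr sA sH sH) => k m n x h g hx hh hg /=.
rewrite tassocVE !tmapE /= tmulE.
(* Mirror image of the left case: [h] and [g] consume the first two legs and the last one survives,
   with the grading factors common to both bracketings. *)
have [Theta ThetaE] : exists Theta : {linear A ⊗ (A ⊗ A) -> A},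
    forall i u v w, hA i w -> Theta (u ⊗: (v ⊗: w)) =
      (c (i * (m + n)) * (p (h ⊗: u) * p (g ⊗: v))) *: w.
  exists (rcoact \o @tflip K H (A ⊗ A) \o @tens K H (A ⊗ A) h \o
    tmap idfun (rcoact \o @tflip K H (A ⊗ A) \o @tens K H (A ⊗ A) g)).
  move=> i u v w hw /=; rewrite tmapE /= !tflipE (rcoact_pure _ hg hw) tensZr.
  rewrite tensZl linearZ /= (rcoact_pure _ hh hw) scalerA.
  by rewrite mulrDr cD; congr (_ *: _); ring.
have [I [i1 [i2 [a [b [ha hb i12 Dx]]]]]] := swA hx.
transitivity (c (- (n * m)) *: Theta (tmap idfun (bdelta HA) (bdelta HA x))).
  have := bdelta_coassoc HA x; rewrite /= => <-.
  rewrite (ract_sum (hom_mul gH hh hg) hb Dx) Dx !linear_sum.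
  apply: eq_bigr => s _ /=; rewrite tmapE /=.
  have [J [j1 [j2 [u [v [hu hv j12 Da]]]]]] := swA (ha s).
  rewrite (pair_mull_sum _ hg hu Da) mulr_sumr scaler_suml.
  rewrite Da tens_suml !linear_sum; apply: eq_bigr => t _ /=.
  rewrite tassocE (ThetaE _ _ _ _ (hb s)) scalerA !mulrA -!cD.
  have [e|ne] := eqVneq (m + j1 t) 0; last first.
    by rewrite (p0 hh (hu t) ne) !(mul0r, mulr0).
  by congr ((c _ * _ * _) *: _); rewrite -(addr0_eq e); ring.
rewrite (ract_sum hh hb Dx) Dx tens_suml !linear_sum; apply: eq_bigr => s _ /=.
have [J [j1 [j2 [u [v [hu hv j12 Db]]]]]] := swA (hb s).
rewrite tmapE /= tensZl linearZ /= (ract_sum hg hv Db) Db !linear_sum.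
apply: eq_bigr => t _ /=; rewrite (ThetaE _ _ _ _ (hv t)) !scalerA.
have [e|ne] := eqVneq (n + j1 t) 0; last first.
  by rewrite (p0 hg (hu t) ne) !(mul0r, mulr0).
(* The constant now comes from [g]: the leg paired with it has degree [- n] and has already been
   crossed by [h]. *)
have -> : c (i2 s * m) = c (- (n * m)) * c (j2 t * m).
  by rewrite -cD -(j12 t) -(addr0_eq e); congr c; ring.
by rewrite mulrDr cD; congr (_ *: _); ring.
Qed.

Lemma right_action_braided : right_braided_action HH Xi' act.
Proof.
split.
- exact (bichar_mulr cD gH sA hXi').
- exact (bichar_mull cD gA sH hXi').
- exact (bichar_comulr cD gH sA hDH hXi').
- exact: right_action_mulA.
- exact: right_action_mulH.
(* As on the left, acting by [h] raises the degree by that of [h], which accounts for the crossing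
   of [h] and [g]. *)
- apply: (tens_extl sA sH sH) => k m n x h g hx hh hg /=.
  have [I [i1 [i2 [a [b [ha hb i12 Dx]]]]]] := swA hx.
  rewrite tmapE (tsnd_pure _ (hpsiH hh hg)) !linearZ /= tmapE /= (hXi' hx hg).
  rewrite tensZl !linearZ /= tassocE tmapE /= !(ract_sum hh hb Dx).
  rewrite tens_suml !linear_sum; apply: eq_bigr => s _ /=.
  rewrite tensZr !tensZl linearZ /= (hXi' (hb s) hg) !scalerA.
  have [e|ne] := eqVneq (m + i1 s) 0; last first.
    by rewrite (p0 hh (ha s) ne) !(mul0r, mulr0).
  rewrite -(i12 s) -(addr0_eq e).
  have -> : c (i2 s * n) = c (m * n) * c ((- m + i2 s) * n).
    by rewrite -cD; congr c; ring.
  by congr (_ *: _); ring.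
- move=> x.
  have : (act \o @tflip K H A \o @tens K H A 1) x = (idfun : {linear A -> A}) x.
    apply: hspan_eq (sA x) => n {}x hx /=.
    have [I [i1 [i2 [a [b [ha hb i12 Dx]]]]]] := swA hx.
    have := bdelta_epsl HA x; rewrite /= Dx !linear_sum => xE.
    rewrite tflipE (ract_sum (hom_one gH) hb Dx) -[RHS]xE.
    apply: eq_bigr => s _.
    by rewrite mulr0 c0 mul1r (pair_onel hp) /= tmapE tunitlE.
  by rewrite /= tflipE.
- move=> h; elim: (sH h) => [m {}h hh||h1 h2 _ E1 _ E2].
  + rewrite ractE bdelta_one (rcoact_pure _ hh (hom_one gA)) mul0r c0 mul1r.
    by rewrite (pair_oner hp).
  + by rewrite !linear0 scale0r.
  + by rewrite !linearD /= E1 E2 scalerDl.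
Qed.
End Right.
End GradedBraidedAction.

(** * Vanishing of the pairing off total degree zero *)

Section GroupLike.
Variables (K : fieldType) (c : int -> K) (B : algType K) (hB : int -> B -> Prop).
Hypotheses (c0 : c 0 = 1) (gB : grading hB).
Variable HB : braidedHopf B.
Hypothesis hpsi : bichar_braiding c hB hB (bpsi HB).

(* Right multiplication by [u ⊗ u] for the braided product. *)
Let rmul (u : B) : {linear B ⊗ B -> B ⊗ B} :=
  tmap (@tmul K B) (@tmul K B) \o tmid (bpsi HB) \o
  @tflip K (B ⊗ B) (B ⊗ B) \o @tens K (B ⊗ B) (B ⊗ B) (u ⊗: u).

(** In degree zero, right multiplication by [u ⊗: u] is componentwise and is undone by [v ⊗: v].
    Applying this to the product of the coproducts of [v] and [u], which is [1 ⊗: 1], gives the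
    claim. *)
Lemma bdelta_inv u v : hB 0 u -> hB 0 v -> u * v = 1 -> v * u = 1 ->
  bdelta HB u = u ⊗: u -> bdelta HB v = v ⊗: v.
Proof.
move=> hu hv uv vu Du.
have rmulE w n a b : hB 0 w -> hB n b ->
    rmul w (a ⊗: b) = (a * w) ⊗: (b * w).
  move=> hw hb; rewrite /rmul /= tflipE (tmid_pure _ _ (hpsi hb hw)) mulr0 c0.
  by rewrite scale1r tmapE /= !tmulE.
have rmulK : rmul v \o rmul u =1 (idfun : {linear B ⊗ B -> B ⊗ B}).
  apply: (tens_ext (hom_span gB) (hom_span gB)) => m n a b ha hb.
  change (rmul v (rmul u (a ⊗: b)) = a ⊗: b); rewrite (rmulE _ _ _ _ hu hb).
  rewrite (rmulE _ _ _ _ hv (hom_mul gB hb hu)).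
  by rewrite -!mulrA uv !mulr1.
have rmulD : rmul u (bdelta HB v) = 1 ⊗: 1.
  have := bdelta_mul HB (v ⊗: u).
  by rewrite /= tmulE tmapE vu bdelta_one Du /rmul /= tflipE => ->.
have <- : rmul v (rmul u (bdelta HB v)) = bdelta HB v := rmulK _.
by rewrite rmulD (rmulE _ _ _ _ hv (hom_one gB)) !mul1r.
Qed.

End GroupLike.

(** * Propagation of the vanishing through the pairing axioms *)

Section PairingDegree.
Variables (K : fieldType) (c : int -> K).
Variables (H A : algType K) (hH : int -> H -> Prop) (hA : int -> A -> Prop).
Hypothesis gH : grading hH.
Variables (HH : braidedHopf H) (HA : braidedHopf A).
Hypothesis hDH : forall n h, hH n h -> thom hH hH n (bdelta HH h).
Variables (Xi : {linear H ⊗ A -> A ⊗ H}) (p : {linear H ⊗ A -> K^o}).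
Hypotheses (hXi : bichar_braiding c hH hA Xi) (hp : braided_pairing HH HA Xi p).

(** A nonzero Sweedler summand requires both of its pairings to have total degree zero, and these
    two degrees add up to the degree of the whole. *)
Lemma pair_degree_mulr n1 n2 x y : hA n1 x ->
  (forall m h, hH m h -> m + n1 != 0 -> p (h ⊗: x) = 0) ->
  (forall m h, hH m h -> m + n2 != 0 -> p (h ⊗: y) = 0) ->
  forall m h, hH m h -> m + (n1 + n2) != 0 -> p (h ⊗: (x * y)) = 0.
Proof.
move=> hx px py m h hh ne.
have [I [i [j [h1 [h2 [hh1 hh2 ij Dh]]]]]] := thom_sum (hom_scale gH) (hDH hh).
rewrite (pair_mulr_sum hXi hp _ hx hh2 Dh); apply: big1 => k _.
have [e1|ne1] := eqVneq (i k + n1) 0; last first.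
  by rewrite (px _ _ (hh1 k) ne1) mul0r mulr0.
have [e2|ne2] := eqVneq (j k + n2) 0; last first.
  by rewrite (py _ _ (hh2 k) ne2) !mulr0.
by case/eqP: ne; rewrite -(ij k) addrACA e1 e2 addr0.
Qed.

(** The predicate [S] restricts the elements against which vanishing is known. Stability under the
    coproduct keeps both Sweedler legs inside it, so an induction on the other argument can be run
    for generators only. *)
Lemma pair_degree_mull (S : int -> A -> Prop) m1 m2 h g :
  (forall n x, S n x -> hA n x) -> (forall n a x, S n x -> S n (a *: x)) ->
  (forall n x, S n x -> thom S S n (bdelta HA x)) -> hH m2 g ->
  (forall n x, S n x -> m1 + n != 0 -> p (h ⊗: x) = 0) ->
  (forall n x, S n x -> m2 + n != 0 -> p (g ⊗: x) = 0) ->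
  forall n x, S n x -> m1 + m2 + n != 0 -> p ((h * g) ⊗: x) = 0.
Proof.
move=> SA SZ SD hg ph pg n x Sx ne.
have [I [i [j [a [b [Sa Sb ij Dx]]]]]] := thom_sum SZ (SD n x Sx).
rewrite (pair_mull_sum hXi hp _ hg (fun k => SA _ _ (Sa k)) Dx).
apply: big1 => k _.
have [e1|ne1] := eqVneq (m1 + i k) 0; last first.
  by rewrite (ph _ _ (Sa k) ne1) mul0r mulr0.
have [e2|ne2] := eqVneq (m2 + j k) 0; last first.
  by rewrite (pg _ _ (Sb k) ne2) !mulr0.
by case/eqP: ne; rewrite -(ij k) addrACA e1 e2 addr0.
Qed.

End PairingDegree.

(** * The quantum groups *)

Lemma homog_span (K : fieldType) (X : Type) (rel : pterm K X -> pterm K X -> Prop)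
  (d : X -> int) (x : presalg rel) : hspan (homog d) x.
Proof.
elim/presalg_ind: x => [x||x y|x y IHx IHy|a x].
- exact: hspan_hom (homog_gen _ _ x).
- exact: hspan_hom (homog_one _ _).
- exact: hspan_add.
- elim: IHx => [m u hu||u v _ IHu _ IHv].
  + elim: IHy => [n v hv||v w _ IHv _ IHw].
    * exact: hspan_hom (homog_mul hu hv).
    * by rewrite mulr0; apply: hspan_zero.
    * by rewrite mulrDr; apply: hspan_add.
  + by rewrite mul0r; apply: hspan_zero.
  + by rewrite mulrDl; apply: hspan_add.
- elim=> [m u hu||u v _ IHu _ IHv].
  + exact: hspan_hom (homog_scale a hu).
  + by rewrite scaler0; apply: hspan_zero.
  + by rewrite scalerDr; apply: hspan_add.
Qed.

Section QuantumAlgebras.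
Variables (R : realType) (q phi : R).

Lemma cexpi0 : cexpi (0 : R) = 1.
Proof. by rewrite /cexpi cos0 sin0. Qed.

Lemma cexpiD (s t : R) : cexpi (s + t) = cexpi s * cexpi t.
Proof. by rewrite /cexpi cosD sinD [sin s * _ + _]addrC. Qed.

(** With this character [degree_braiding] unfolds to [bichar_braiding], so the general results apply
    to its instances directly. *)
Definition bichar (n : int) : R[i] := cexpi (2 * phi * n%:~R).

Lemma bichar0 : bichar 0 = 1.
Proof. by rewrite /bichar mulr0 cexpi0. Qed.

Lemma bicharD m n : bichar (m + n) = bichar m * bichar n.
Proof. by rewrite /bichar intrD mulrDr cexpiD. Qed.

Lemma SU_grading : grading (@SU_homog R q phi).
Proof.
split.
- exact: homog_span.
- exact: homog_one.
- exact: homog_mul.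
- exact: homog_scale.
Qed.

Lemma U_grading : grading (@U_homog R q phi).
Proof.
split.
- exact: homog_span.
- exact: homog_one.
- exact: homog_mul.
- exact: homog_scale.
Qed.

Variables (HA : braidedHopf (SU2 q phi)) (HH : braidedHopf (U2 q phi)).
Hypotheses (hA : is_SU2 HA) (hH : is_U2 HH).

(* Unlike the homogeneous elements, the multiples of generators have coproducts
   that involve generators only, which starts the induction on [h]. *)
Definition SU_genline (n : int) (x : SU2 q phi) : Prop :=
  exists a g, SU_deg g = n /\ x = a *: gSU q phi g.

Lemma SU_genline_scale n a x : SU_genline n x -> SU_genline n (a *: x).
Proof. by case=> b [g [gn ->]]; exists (a * b), g; rewrite scalerA. Qed.

Lemma SU_genline_homog n x : SU_genline n x -> SU_homog n x.
Proof. by case=> a [g [<- ->]]; apply: homog_scale; apply: homog_gen. Qed.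

Lemma SU_genline_bdelta n x :
  SU_genline n x -> thom SU_genline SU_genline n (bdelta HA x).
Proof.
case=> a [g [<- ->]]; rewrite linearZ; apply: thom_scale.
have G h : SU_genline (SU_deg h) (gSU q phi h) by exists 1, h; rewrite scale1r.
case: g; [rewrite (SU_delta_a hA)|rewrite (SU_delta_c hA)
  |rewrite (SU_delta_a' hA)|rewrite (SU_delta_c' hA)];
  rewrite -?scaleNr; apply: thom_add; try apply: thom_scale;
  exact: thom_pure (G _) (G _) _.
Qed.

Lemma SU_thom_bdelta n x :
  SU_homog n x -> thom (@SU_homog R q phi) (@SU_homog R q phi) n (bdelta HA x).
Proof.
elim=> [g||i j y z _ IHy _ IHz|m|m y z _ IHy _ IHz|m a y _ IHy].
- have Sg : SU_genline (SU_deg g) (gSU q phi g) by exists 1, g; rewrite scale1r.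
  by apply: thom_sub (SU_genline_bdelta Sg) => *; apply: SU_genline_homog.
- rewrite bdelta_one; apply: thom_pure (addr0 0); exact: homog_one.
- exact (thom_bdelta_mul (c := bichar) SU_grading (SU_psi hA) IHy IHz).
- by rewrite linear0; apply: thom_zero.
- by rewrite linearD; apply: thom_add.
- by rewrite linearZ; apply: thom_scale.
Qed.

Lemma U_gen_homog g : U_homog (U_deg g) (gU q phi g).
Proof. exact: homog_gen. Qed.

Lemma U_inv (g g' : U_gen) :
  U_rel q phi (PVar _ g * PVar _ g')%pterm 1%pterm -> gU q phi g * gU q phi g' = 1.
Proof.
by move=> gg'; rewrite [LHS]presalg_mulE; apply/presalg_eqP; apply: pc_rel.
Qed.

(** The record [is_U2] gives coproducts for [Kk] and [KkS] only; those of the inverses are forced by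
    multiplicativity. *)
Lemma U_delta_kV : bdelta HH (gU q phi KkV) = gU q phi KkV ⊗: gU q phi KkV.
Proof.
apply: (bdelta_inv (c := bichar) bichar0 U_grading (U_psi hH)
  (U_gen_homog Kk) (U_gen_homog KkV) _ _ (U_delta_k hH));
  by apply: U_inv; constructor.
Qed.

Lemma U_delta_k'V : bdelta HH (gU q phi KkSV) = gU q phi KkSV ⊗: gU q phi KkSV.
Proof.
apply: (bdelta_inv (c := bichar) bichar0 U_grading (U_psi hH)
  (U_gen_homog KkS) (U_gen_homog KkSV) _ _ (U_delta_k' hH));
  by apply: U_inv; constructor.
Qed.

Lemma U_thom_bdelta n x :
  U_homog n x -> thom (@U_homog R q phi) (@U_homog R q phi) n (bdelta HH x).
Proof.
elim=> [g||i j y z _ IHy _ IHz|m|m y z _ IHy _ IHz|m a y _ IHy].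
- case: g; [rewrite (U_delta_e hH)|rewrite (U_delta_f hH)
    |rewrite (U_delta_k hH)|rewrite (U_delta_k' hH)
    |rewrite U_delta_kV|rewrite U_delta_k'V];
    try apply: thom_add; exact: thom_pure (U_gen_homog _) (U_gen_homog _) _.
- rewrite bdelta_one; apply: thom_pure (addr0 0); exact: homog_one.
- exact (thom_bdelta_mul (c := bichar) U_grading (U_psi hH) IHy IHz).
- by rewrite linear0; apply: thom_zero.
- by rewrite linearD; apply: thom_add.
- by rewrite linearZ; apply: thom_scale.
Qed.

(** The counit is multiplicative and kills the generators of nonzero degree; a product of nonzero
    degree has a factor of nonzero degree. This settles the unit case of the pairing induction. *)
Lemma U_eps_degree n h : U_homog n h -> n != 0 -> beps HH h = 0.
Proof.
elim=> [[]||i j y z _ IHy _ IHz ij|m|m y z _ IHy _ IHz ne|m a y _ IHy ne] //.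
- by move=> _; apply: (U_eps_e hH).
- by move=> _; apply: (U_eps_f hH).
- rewrite beps_mul; have [i0|/IHy->] := eqVneq i 0; last by rewrite mul0r.
  by rewrite IHz ?mulr0 //; apply: contraNneq ij => ->; rewrite i0.
- by rewrite linear0.
- by rewrite linearD /= IHy // IHz // addr0.
- by rewrite linearZ /= IHy // scaler0.
Qed.

Lemma SU_eps_degree n x : SU_homog n x -> n != 0 -> beps HA x = 0.
Proof.
elim=> [[]||i j y z _ IHy _ IHz ij|m|m y z _ IHy _ IHz ne|m a y _ IHy ne] //.
- by move=> _; apply: (SU_eps_c hA).
- by move=> _; apply: (SU_eps_c' hA).
- rewrite beps_mul; have [i0|/IHy->] := eqVneq i 0; last by rewrite mul0r.
  by rewrite IHz ?mulr0 //; apply: contraNneq ij => ->; rewrite i0.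
- by rewrite linear0.
- by rewrite linearD /= IHy // IHz // addr0.
- by rewrite linearZ /= IHy // scaler0.
Qed.

Variables (Xi : {linear U2 q phi ⊗ SU2 q phi -> SU2 q phi ⊗ U2 q phi})
  (p : {linear U2 q phi ⊗ SU2 q phi -> R[i]^o}).
Hypotheses (hXi : degree_braiding phi (@U_homog R q phi) (@SU_homog R q phi) Xi)
  (hp : braided_pairing HH HA Xi p).
Hypothesis hgen : forall (h : U_gen) (x : SU_gen),
  p (gU q phi h ⊗: gSU q phi x) = pair_gen q phi h x.

(** Induction on [h]: a product in [h] splits the coproduct of [x], whose legs are again multiples
    of generators, so the induction hypotheses apply to them. *)
Lemma pairing_degree_gen m h n x : U_homog m h -> SU_genline n x ->
  m + n != 0 -> p (h ⊗: x) = 0.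
Proof.
move=> hh; elim: hh n x => {m h} [g||i j y z hy IHy hz IHz|m|m y z _ IHy _ IHz
  |m a y _ IHy] n x Sx ne.
- case: Sx ne => a [g' [<- ->]].
  have pE : p (gU q phi g ⊗: (a *: gSU q phi g')) = a * pair_gen q phi g g'.
    by rewrite tensZr linearZ -hgen.
  move=> ne; apply: (etrans pE).
  (* Either the degrees of the two generators cancel, against [ne], or [pair_gen] is 0. *)
  by move: ne {pE}; case: g; case: g' => // _; rewrite mulr0.
- rewrite add0r in ne.
  exact (etrans (pair_onel hp x) (SU_eps_degree (SU_genline_homog Sx) ne)).
- exact (pair_degree_mull (c := bichar) hXi hp SU_genline_homog
    SU_genline_scale SU_genline_bdelta hz IHy IHz Sx ne).
- by rewrite tens0l linear0.
- by rewrite tensDl linearD /= (IHy n) // (IHz n) // addr0.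
- by rewrite tensZl linearZ /= (IHy n) // scaler0.
Qed.

(** Second induction, on [x]: a product in [x] splits the coproduct of [h], so the claim is kept
    general in [h]. Generators are covered by [pairing_degree_gen]. *)
Lemma pairing_degree m n h x : U_homog m h -> SU_homog n x ->
  m + n != 0 -> p (h ⊗: x) = 0.
Proof.
move=> hh hx; elim: hx m h hh => {n x} [g||i j y z hy IHy hz IHz|n|n y z _ IHy _
  IHz|n a y _ IHy] m h hh ne.
- by apply: pairing_degree_gen hh _ ne; exists 1, g; rewrite scale1r.
- rewrite addr0 in ne.
  exact (etrans (pair_oner hp h) (U_eps_degree hh ne)).
- exact (pair_degree_mulr (c := bichar) U_grading U_thom_bdelta hXi hp hy
    IHy IHz hh ne).
- by rewrite !linear0.
- by rewrite !linearD /= (IHy m) // (IHz m) // addr0.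
- by rewrite !linearZ /= (IHy m) // scaler0.
Qed.

End QuantumAlgebras.

Unset Implicit Arguments.

Theorem theorem3p13 (R : realType) (q phi : R)
  (hq : 0 < q < 1) (hphi : 0 <= phi < 2 * pi)
  (HA : braidedHopf (SU2 q phi)) (HH : braidedHopf (U2 q phi))
  (hA : is_SU2 HA) (hH : is_U2 HH)
  (Xi : {linear U2 q phi ⊗ SU2 q phi -> SU2 q phi ⊗ U2 q phi})
  (hXi : degree_braiding phi (@U_homog R q phi) (@SU_homog R q phi) Xi)
  (Xi' : {linear SU2 q phi ⊗ U2 q phi -> U2 q phi ⊗ SU2 q phi})
  (hXi' : degree_braiding phi (@SU_homog R q phi) (@U_homog R q phi) Xi')
  (pairing : {linear U2 q phi ⊗ SU2 q phi -> R[i]^o})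
  (hpair : braided_pairing HH HA Xi pairing)
  (hgen : forall (h : U_gen) (x : SU_gen),
     pairing (gU q phi h ⊗: gSU q phi x) = pair_gen q phi h x) :
  left_braided_module_algebra HH Xi (left_action HA Xi pairing) /\
  right_braided_action HH Xi'
    (right_action HA Xi' (pairing \o @tflip _ (SU2 q phi) (U2 q phi))).
Proof.
have p0 := pairing_degree hA hH hXi hpair hgen.
split.
- exact (left_action_module_algebra (c := bichar phi) (bichar0 phi)
    (bicharD phi) (U_grading q phi) (SU_grading q phi) (U_psi hH) (SU_psi hA)
    (U_thom_bdelta hH) (SU_thom_bdelta hA) hXi hpair p0).
- exact (right_action_braided (c := bichar phi) (bichar0 phi)
    (bicharD phi) (U_grading q phi) (SU_grading q phi) (U_psi hH) (SU_psi hA)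
    (U_thom_bdelta hH) (SU_thom_bdelta hA) hXi hpair p0 hXi').
Qed.
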